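(* Let $G$ be a Lie group with non-abelian Lie algebra $\mathfrak g$, and let $\{J_i\}_{i=1,2,3}$ be an abelian hypercomplex structure on $\mathfrak g$. Then $\{J_i\}_{i=1,2,3}$ gives rise to an invariant weak HKT structure on $G$: for every inner product $g$ on $\mathfrak g$ with $g(J_iX,J_iY)=g(X,Y)$ for all $X,Y\in\mathfrak g$ and $i=1,2,3$, the left-invariant structure on $G$ induced by $(\{J_i\}_{i=1,2,3},g)$ is an HKT structure, and its torsion 3-form $c$ satisfies $dc\neq0$.
   Context: A hypercomplex structure on a (finite-dimensional real) Lie algebra $\mathfrak g$ is a triple of endomorphisms $\{J_i\}_{i=1,2,3}$ with $J_i^2=-I$, $J_1J_2=-J_2J_1=J_3$ and vanishing Nijenhuis tensors $N_i(X,Y)=J_i([X,Y]-[J_iX,J_iY])-([J_iX,Y]+[X,J_iY])$, $i=1,2,3$. It is called abelian if $[J_iX,J_iY]=[X,Y]$ for all $X,Y\in\mathfrak g$, $i=1,2,3$. A hyperhermitian manifold $(M,\{J_i\}_{i=1,2,3},g)$ is HKT if there is a connection $\nabla$ with $\nabla g=0$, $\nabla J_i=0$ for $i=1,2,3$, and such that $c(X,Y,Z)=g(X,T(Y,Z))$ is a 3-form, where $T$ is the torsion of $\nabla$. Such a connection is unique (the Bismut connection) and $c$ is called the torsion 3-form. The HKT structure is called strong if $dc=0$ and weak if $dc\ne0$. A left-invariant structure on a Lie group is one obtained by left translating the $J_i$ and $g$ from the Lie algebra. *)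

(* Defs.v *)
From HB Require Import structures.
From mathcomp Require Import all_boot all_order all_algebra.
From mathcomp Require Import all_classical all_reals all_analysis.
Set Implicit Arguments.
Unset Strict Implicit.
Unset Printing Implicit Defensive.
Import Order.TTheory GRing.Theory Num.Theory.
Import numFieldNormedType.Exports.
Local Open Scope classical_set_scope.
Local Open Scope ring_scope.

HB.mixin Record isLieAlgebra (R : fieldType) V of Vector R V := {
  lie : V -> V -> V;
  lie_linearl : forall (a : R) (X Y Z : V),
    lie (a *: X + Y) Z = a *: lie X Z + lie Y Z;
  lie_linearr : forall (a : R) (X Y Z : V),
    lie X (a *: Y + Z) = a *: lie X Y + lie X Z;
  lie_alternating : forall X : V, lie X X = 0;
  lie_jacobi : forall X Y Z : V,
    lie X (lie Y Z) + lie Y (lie Z X) + lie Z (lie X Y) = 0 }.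

#[short(type="lieAlgebraType")]
HB.structure Definition LieAlgebra (R : fieldType) :=
  {V of isLieAlgebra R V & Vector R V}.

(* J_1, J_2, J_3 are indexed here by 0, 1, 2 : 'I_3. *)
Definition quaternionic (V : zmodType) (J : 'I_3 -> V -> V) : Prop :=
  (forall i X, J i (J i X) = - X) /\
  (forall X, J 0 (J 1 X) = J 2 X /\ J 1 (J 0 X) = - J 2 X).

Definition nijenhuis (V : zmodType) (br : V -> V -> V) (J : V -> V) (X Y : V)
    : V :=
  J (br X Y - br (J X) (J Y)) - (br (J X) Y + br X (J Y)).

Definition inner_product (R : realType) (V : lmodType R) (b : V -> V -> R)
    : Prop :=
  [/\ forall a X Y Z, b (a *: X + Y) Z = a * b X Z + b Y Z,
      forall X Y, b X Y = b Y X
    & forall X, X != 0 -> 0 < b X X].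

Definition nonabelian_lie (R : fieldType) (g : lieAlgebraType R) : Prop :=
  exists X Y : g, lie X Y <> 0.

Definition hypercomplex_lie (R : fieldType) (g : lieAlgebraType R)
    (J : 'I_3 -> 'End(g)) : Prop :=
  quaternionic (fun i => J i : g -> g) /\
  forall i X Y, nijenhuis (@lie R g) (J i) X Y = 0.

Definition abelian_hypercomplex_lie (R : fieldType) (g : lieAlgebraType R)
    (J : 'I_3 -> 'End(g)) : Prop :=
  hypercomplex_lie J /\ forall i X Y, lie (J i X) (J i Y) = lie X Y.

(* C^k on an open set U: f is (Frechet) differentiable on U and its directional
   derivatives are C^(k-1). *)
Fixpoint Ck_on (R : realType) (V W : normedModType R) (k : nat) (U : set V)
    (f : V -> W) : Prop :=
  if k is k'.+1 then
    (forall x, U x -> differentiable f x) /\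
    (forall v, Ck_on k' U (fun x => 'd f x v))
  else forall x, U x -> {for x, continuous f}.

Definition smooth_on (R : realType) (V W : normedModType R) (U : set V)
    (f : V -> W) : Prop := forall k, Ck_on k U f.

(* An atlas indexed by the points of T: chart p is a chart around p, with domain
   dom p and (total) inverse psi p, meaningful on cod p only. *)
Record charts (R : realType) (E : normedModType R) (T : topologicalType) :=
  Charts {
    dom : T -> set T;
    phi : T -> T -> E;
    psi : T -> E -> T }.

Definition cod (R : realType) (E : normedModType R) (T : topologicalType)
  (A : charts E T) (p : T) : set E := phi A p @` dom A p.

Definition is_manifold (R : realType) (E : normedModType R)
    (T : topologicalType) (A : charts E T) : Prop :=
  [/\ hausdorff_space T, @second_countable T,
      (forall p, [/\ dom A p p, open (dom A p), open (cod A p)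
                   & forall q, dom A p q -> psi A p (phi A p q) = q]),
      (forall p, {within dom A p, continuous (phi A p)} /\
                 {within cod A p, continuous (psi A p)})
    & forall p q, smooth_on (cod A p `&` psi A p @^-1` dom A q)
                            (phi A q \o psi A p)].

Definition prod_charts (R : realType) (E F : normedModType R)
    (S T : topologicalType) (A : charts E S) (B : charts F T)
    : charts (E * F)%type (S * T)%type :=
  Charts (fun p => dom A p.1 `*` dom B p.2)
         (fun p q => (phi A p.1 q.1, phi B p.2 q.2))
         (fun p x => (psi A p.1 x.1, psi B p.2 x.2)).

Definition smooth_map (R : realType) (E F : normedModType R)
    (S T : topologicalType) (A : charts E S) (B : charts F T) (f : S -> T)
    : Prop :=
  continuous f /\
  forall p q, smooth_on (cod A p `&` (f \o psi A p) @^-1` dom B q)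
                        (phi B q \o f \o psi A p).

(* The tangent space at p is identified with E through the chart at p, so a
   vector field is a function T -> E and a tensor field a function of p : T whose
   values are tensors on E. *)
Section Fields.
Context (R : realType) (E : normedModType R) (T : topologicalType).
Variable A : charts E T.

Definition smooth_fun (f : T -> R) : Prop :=
  forall p, smooth_on (cod A p) (f \o psi A p).

Definition tangent_map (F : T -> T) (p : T) (v : E) : E :=
  'd (phi A (F p) \o F \o psi A p) (phi A p p) v.

(* components of X in the chart at p *)
Definition local_rep (X : T -> E) (p : T) (x : E) : E :=
  let q := psi A p x in 'd (phi A p \o psi A q) (phi A q q) (X q).

Definition smooth_vfield (X : T -> E) : Prop :=
  forall p, smooth_on (cod A p) (local_rep X p).

(* the function X(f) *)
Definition vderiv (X : T -> E) (f : T -> R) (p : T) : R :=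
  'd (f \o psi A p) (phi A p p) (X p).

(* X^i d_i Y^j - Y^i d_i X^j, computed at p in the chart at p *)
Definition vbracket (X Y : T -> E) (p : T) : E :=
  'd (local_rep Y p) (phi A p p) (X p) - 'd (local_rep X p) (phi A p p) (Y p).

Definition app_endo (J : T -> E -> E) (X : T -> E) : T -> E :=
  fun p => J p (X p).

Definition app_metric (g : T -> E -> E -> R) (X Y : T -> E) : T -> R :=
  fun p => g p (X p) (Y p).

Definition smooth_endo (J : T -> E -> E) : Prop :=
  (forall p, linear (J p)) /\
  forall X, smooth_vfield X -> smooth_vfield (app_endo J X).

Definition riemannian (g : T -> E -> E -> R) : Prop :=
  (forall p, inner_product (g p)) /\
  forall X Y, smooth_vfield X -> smooth_vfield Y ->
    smooth_fun (app_metric g X Y).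

Definition hypercomplex (J : 'I_3 -> T -> E -> E) : Prop :=
  [/\ forall i, smooth_endo (J i),
      forall p, quaternionic (fun i => J i p)
    & forall i X Y, smooth_vfield X -> smooth_vfield Y ->
        nijenhuis vbracket (app_endo (J i)) X Y = 0].

Definition hyperhermitian (J : 'I_3 -> T -> E -> E) (g : T -> E -> E -> R)
    : Prop :=
  [/\ hypercomplex J, riemannian g
    & forall i p u v, g p (J i p u) (J i p v) = g p u v].

Definition connection (D : (T -> E) -> (T -> E) -> T -> E) : Prop :=
  [/\ forall X Y, smooth_vfield X -> smooth_vfield Y -> smooth_vfield (D X Y),
      forall f X X' Y, smooth_fun f ->
        smooth_vfield X -> smooth_vfield X' -> smooth_vfield Y ->
        D (fun p => f p *: X p + X' p) Y = (fun p => f p *: D X Y p + D X' Y p)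
    & forall f X Y Y', smooth_fun f ->
        smooth_vfield X -> smooth_vfield Y -> smooth_vfield Y' ->
        D X (fun p => f p *: Y p + Y' p) =
        (fun p => vderiv X f p *: Y p + f p *: D X Y p + D X Y' p)].

Definition torsion (D : (T -> E) -> (T -> E) -> T -> E) (X Y : T -> E)
    : T -> E :=
  fun p => D X Y p - D Y X p - vbracket X Y p.

(* Linearity in the last two arguments follows by skew-symmetry. *)
Definition three_form (c : (T -> E) -> (T -> E) -> (T -> E) -> T -> R)
    : Prop :=
  [/\ forall X Y Z, smooth_vfield X -> smooth_vfield Y -> smooth_vfield Z ->
        smooth_fun (c X Y Z),
      forall f X X' Y Z, smooth_fun f -> smooth_vfield X -> smooth_vfield X' ->
        smooth_vfield Y -> smooth_vfield Z ->
        c (fun p => f p *: X p + X' p) Y Z =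
        (fun p => f p * c X Y Z p + c X' Y Z p)
    & forall X Y Z, smooth_vfield X -> smooth_vfield Y -> smooth_vfield Z ->
        forall p, c Y X Z p = - c X Y Z p /\ c X Z Y p = - c X Y Z p].

Definition ext_deriv3 (c : (T -> E) -> (T -> E) -> (T -> E) -> T -> R)
    (X0 X1 X2 X3 : T -> E) (p : T) : R :=
  vderiv X0 (c X1 X2 X3) p - vderiv X1 (c X0 X2 X3) p
  + vderiv X2 (c X0 X1 X3) p - vderiv X3 (c X0 X1 X2) p
  - c (vbracket X0 X1) X2 X3 p + c (vbracket X0 X2) X1 X3 p
  - c (vbracket X0 X3) X1 X2 p - c (vbracket X1 X2) X0 X3 p
  + c (vbracket X1 X3) X0 X2 p - c (vbracket X2 X3) X0 X1 p.

Definition closed_three_form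
    (c : (T -> E) -> (T -> E) -> (T -> E) -> T -> R) : Prop :=
  forall X0 X1 X2 X3, smooth_vfield X0 -> smooth_vfield X1 ->
    smooth_vfield X2 -> smooth_vfield X3 ->
    forall p, ext_deriv3 c X0 X1 X2 X3 p = 0.

Definition torsion_form (g : T -> E -> E -> R)
    (D : (T -> E) -> (T -> E) -> T -> E) (X Y Z : T -> E) : T -> R :=
  app_metric g X (torsion D Y Z).

Definition bismut_connection (J : 'I_3 -> T -> E -> E) (g : T -> E -> E -> R)
    (D : (T -> E) -> (T -> E) -> T -> E) : Prop :=
  [/\ connection D,
      forall X Y Z, smooth_vfield X -> smooth_vfield Y -> smooth_vfield Z ->
        forall p, vderiv X (app_metric g Y Z) p =
          app_metric g (D X Y) Z p + app_metric g Y (D X Z) p,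
      forall i X Y, smooth_vfield X -> smooth_vfield Y ->
        D X (app_endo (J i) Y) = app_endo (J i) (D X Y)
    & three_form (torsion_form g D)].

Definition HKT (J : 'I_3 -> T -> E -> E) (g : T -> E -> E -> R) : Prop :=
  hyperhermitian J g /\ exists D, bismut_connection J g D.

(* The Bismut connection is unique, so this says that its torsion form c
   satisfies dc <> 0. *)
Definition weak_HKT (J : 'I_3 -> T -> E -> E) (g : T -> E -> E -> R) : Prop :=
  HKT J g /\
  forall D, bismut_connection J g D -> ~ closed_three_form (torsion_form g D).

End Fields.

#[short(type="topologicalGroupType")]
HB.structure Definition TopologicalGroup := {G of Topological G & Group G}.

Section LieGroups.
Context (R : realType) (n : nat) (G : topologicalGroupType).
Variable A : charts 'rV[R]_n G.

Definition is_lie_group : Prop :=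
  [/\ is_manifold A,
      smooth_map (prod_charts A A) A (fun x : G * G => (x.1 * x.2)%g)
    & smooth_map A A (fun x : G => (x^-1)%g)].

Definition left_invariant (X : G -> 'rV[R]_n) : Prop :=
  smooth_vfield A X /\
  forall a p, X (a * p)%g = tangent_map A (fun x => (a * x)%g) p (X p).

Context (g : lieAlgebraType R).

(* L identifies g with the Lie algebra of left-invariant vector fields. *)
Definition is_lie_algebra_of (L : g -> G -> 'rV[R]_n) : Prop :=
  [/\ forall a X Y p, L (a *: X + Y) p = a *: L X p + L Y p,
      injective L,
      forall V : G -> 'rV[R]_n, left_invariant V <-> exists X, L X = V
    & forall X Y, L (lie X Y) = vbracket A (L X) (L Y)].

Variable L : g -> G -> 'rV[R]_n.

(* the X in g whose left-invariant field takes the value v at p, that is, the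
   tangent vector v left translated to the identity *)
Definition left_translate (p : G) (v : 'rV[R]_n) : g :=
  xget 0 [set X | L X p = v].

Definition left_inv_endo (J : 'I_3 -> 'End(g)) (i : 'I_3) (p : G)
    (v : 'rV[R]_n) : 'rV[R]_n :=
  L (J i (left_translate p v)) p.

Definition left_inv_metric (b : g -> g -> R) (p : G) (u v : 'rV[R]_n) : R :=
  b (left_translate p u) (left_translate p v).

End LieGroups.

(* Main.v *)
Require Import Defs.
From HB Require Import structures.
From mathcomp Require Import all_boot all_order all_algebra.
From mathcomp Require Import all_classical all_reals all_analysis.
From mathcomp Require Import ring lra.
Import Order.TTheory GRing.Theory Num.Theory.
Import numFieldNormedType.Exports.

(** Left-invariant fields form a frame, so a vector field [X] on [G] amounts to a
    function [x : G -> g], its image under the Maurer-Cartan form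
    ([maurer_cartan]), which is smooth exactly when [X] is. In these terms
    everything is explicit: the bracket of [X] and [Y] is
    [X(y) - Y(x) + lie x y] ([vbracketE]), the complex structures act by
    [x |-> J i x], and the metric is [b x y].

    Existence. Let [B] be the bilinear map on [g] with
    [b (B x y) z = - b x (lie y z)], and set [D_X Y = X(y) + B x y]. As the
    bracket is skew, [D] is metric; as the structure is abelian,
    [lie (J i y) z = - lie y (J i z)], so [D] commutes with [J i]
    ([bismut_tensor_J]); its torsion form is minus the cyclic sum of
    [b x (lie y z)], which is a 3-form ([torsion_form_bismut]). The Nijenhuis
    tensors vanish by a cancellation of derivative terms, and the structure is
    HKT ([HKT_left_inv]).

    Weakness. The torsion form of any Bismut connection agrees with that cyclic
    sum on left-invariant fields ([torsion_form_ev]): the difference of two such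
    connections is a 3-form invariant under [J i] in two slots, hence zero
    ([skew_tensor_eq0]). By the Jacobi identity its exterior derivative is twice
    an alternating sum of inner products of brackets ([dtorsion3E]). If it
    vanishes then, with [J] one complex structure and [K] another,
    evaluation on [X, JX, Y, JY] shows that
    [b (lie X JX) (lie Y JY)] equals
    [b (lie X Y) (lie X Y) + b (lie X JY) (lie X JY)]; the choice [Y = KX] makes
    the left side nonpositive, so all [lie X JX] vanish, and then the right side
    forces [lie X Y = 0] for all [X] and [Y] ([closed_torsion3_lie0]).

    The analytic part supplies the calculus behind the first paragraph. The
    existence of left-invariant fields with a given value at the identity
    ([left_field]) rests on the smoothness of the group law, and the smoothness of
    [x] on Cramer's rule for the matrix of the frame in a chart
    ([smooth_maurer_cartan]). *)

Local Open Scope ring_scope.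
Set Implicit Arguments.
Unset Strict Implicit.
Unset Printing Implicit Defensive.
Local Open Scope classical_set_scope.

(** * Calculus of C^k maps between normed spaces *)

Section Calculus.
Context {R : realType}.
Implicit Types V W : normedModType R.

Lemma is_diff_near0 V W (e : V -> W) (x : V) :
  (\forall y \near x, e y = 0) -> is_diff x e 0.
Proof.
move=> e0.
have ex0 : e x = 0 by exact: (nbhs_singleton e0).
have H : e \o shift x = cst (e x) + (0 : V -> W) +o_ (0 : V) id.
  apply/eqaddoP => _/posnumP[eps].
  have : \forall y \near (0 : V), e (y + x) = 0.
    by move: e0; rewrite (near_shift 0 x) subr0.
  apply: filterS => y ey.
  rewrite -![(_ + _ : _ -> _) _]/(_ + _) -[(- _ : _ -> _) _]/(- _).
  by rewrite /= ey ex0 /cst addr0 subr0 normr0 mulr_ge0.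
have E : 'd e x = 0 :> (V -> W).
  by apply/diff_unique => // ?; exact: cst_continuous.
apply: DiffDef => //; apply/diff_locallyP; rewrite E.
by split => // ?; exact: cst_continuous.
Qed.

(** The differential is chosen from an expansion in Landau notation, so locality
    is a statement about remainders: [g - f] vanishes near [x], hence has
    differential 0 there. *)
Lemma is_diff_near V W (f g df : V -> W) (x : V) :
  (\forall y \near x, f y = g y) -> is_diff x f df -> is_diff x g df.
Proof.
move=> fg dfx.
have e0 : is_diff x (g - f) 0.
  by apply: is_diff_near0; apply: filterS fg => y E; rewrite !fctE E subrr.
have -> : g = f + (g - f) by rewrite addrC subrK.
by rewrite -[df]addr0; exact: is_diffD.
Qed.

(** The Leibniz rule for scaling is the chain rule for the continuous bilinear
    map [*:] applied to the pair of [f] and [g]. *)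
Lemma is_diff_scale V W (f df : V -> R) (g dg : V -> W) (x : V) :
  is_diff x f df -> is_diff x g dg ->
  is_diff x (fun y => f y *: g y) (fun v => f x *: dg v + df v *: g x).
Proof.
move=> fx gx.
have bil : bilinear_for (GRing.Scale.Law.clone _ _ *:%R _)
    (GRing.Scale.Law.clone _ _ *:%R _) (fun (a : R) (w : W) => a *: w).
  split=> [w|a] k y z /=; first by rewrite scalerDl scalerA.
  by rewrite scalerDr !scalerA mulrC.
pose sM := bilinear_isBilinear.Build R R W W _ _ _ bil.
pose s : {bilinear R -> W -> W} := HB.pack (fun (a : R) (w : W) => a *: w) sM.
have sc : continuous (fun p : R * W => s p.1 p.2) by move=> p; exact: scale_continuous.
have ds : is_diff (f x, g x) (fun p : R * W => s p.1 p.2)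
    (fun q => f x *: q.2 + q.1 *: g x).
  by apply: DiffDef; [exact: differentiable_bilin|rewrite diff_bilin].
exact: (is_diff_comp (is_diff_pair fx gx) ds).
Qed.

Lemma is_diff_sum V W (I : Type) (r : seq I) (F dF : I -> V -> W) (x : V) :
  (forall i, is_diff x (F i) (dF i)) ->
  is_diff x (fun y => \sum_(i <- r) F i y) (fun v => \sum_(i <- r) dF i v).
Proof.
move=> dFx; elim: r => [|i r IH].
  under eq_fun do rewrite big_nil.
  under [X in is_diff _ _ X]eq_fun do rewrite big_nil.
  exact: is_diff_cst.
under eq_fun do rewrite big_cons.
under [X in is_diff _ _ X]eq_fun do rewrite big_cons.
exact: (is_diffD (dFx i) IH).
Qed.

Lemma Ck_on_sub V W k (U U' : set V) (f : V -> W) :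
  U `<=` U' -> Ck_on k U' f -> Ck_on k U f.
Proof.
move=> UU'; elim: k f => [|k IH] f /=; first by move=> h x /UU'/h.
by move=> [h1 h2]; split=> [x /UU'/h1|v] //; exact/IH.
Qed.

(** On an open [U] the functions agree near each point of [U], so their
    differentials agree on [U] as well and induction on [k] applies. The closure
    properties below replace the differential of a sum, product or composite by
    a formula valid on [U] only; this is why they assume [U] open. *)
Lemma Ck_on_eq V W k (U : set V) (f g : V -> W) : open U ->
  (forall x, U x -> f x = g x) -> Ck_on k U f -> Ck_on k U g.
Proof.
move=> oU.
have near_fg (h1 h2 : V -> W) : (forall x, U x -> h1 x = h2 x) ->
    forall x, U x -> \forall y \near x, h1 y = h2 y.
  by move=> E x Ux; apply: filterS (open_nbhs_nbhs (conj oU Ux)) => y /E.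
elim: k f g => [|k IH] f g fg /=.
  move=> fc x Ux; rewrite /prop_for /continuous_at -(fg x Ux).
  by apply: cvg_trans (fc x Ux); apply: near_eq_cvg; exact: near_fg.
move=> [df dfv].
have dg x : U x -> is_diff x g ('d f x).
  by move=> Ux; apply: (is_diff_near (near_fg _ _ fg x Ux)); exact/differentiableP/df.
split=> [x /dg[]//|v]; apply: IH (dfv v) => x /dg[_ ->] //.
Qed.

Lemma Ck_onS V W k (U : set V) (f : V -> W) : Ck_on k.+1 U f -> Ck_on k U f.
Proof.
elim: k f => [|k IH] f; first by move=> [df _] x /df; exact: differentiable_continuous.
by move=> [df dfv]; split=> // v; apply: IH; exact: dfv.
Qed.

Lemma Ck_on_cst V W k (U : set V) (c : W) : Ck_on k U (fun=> c).
Proof.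
elim: k c => [|k IH] c /=; first by move=> x _; exact: cst_continuous.
split=> [x _|v]; first exact: differentiable_cst.
by rewrite (_ : (fun=> _) = fun=> 0) //; apply/funext => x; rewrite diff_cst.
Qed.

Lemma Ck_onD V W k (U : set V) (f g : V -> W) : open U ->
  Ck_on k U f -> Ck_on k U g -> Ck_on k U (fun x => f x + g x).
Proof.
move=> oU; elim: k f g => [|k IH] f g /=.
  by move=> cf cg x Ux; apply: continuousD; [exact: cf|exact: cg].
move=> [df dfv] [dg dgv]; split=> [x Ux|v].
  by apply: differentiableD; [exact: df|exact: dg].
apply: (Ck_on_eq oU _ (IH _ _ (dfv v) (dgv v))) => x Ux.
rewrite [in RHS](_ : (fun y => f y + g y) = f + g) // diffD //.
  exact: df.
exact: dg.
Qed.

(** By the Leibniz rule the directional derivatives are sums of products of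
    a [k]-times differentiable factor with a derivative. *)
Lemma Ck_on_scale V W k (U : set V) (f : V -> R) (g : V -> W) : open U ->
  Ck_on k U f -> Ck_on k U g -> Ck_on k U (fun x => f x *: g x).
Proof.
move=> oU; elim: k f g => [|k IH] f g.
  by move=> cf cg x Ux; apply: continuousZ; [exact: cf|exact: cg].
move=> Cf Cg; have [df dfv] := Cf; have [dg dgv] := Cg.
have H x : U x -> is_diff x (fun x => f x *: g x)
    (fun v => f x *: 'd g x v + 'd f x v *: g x).
  by move=> Ux; apply: is_diff_scale; apply: differentiableP; [exact: df|exact: dg].
split=> [x /H[]//|v].
have C := Ck_onD oU (IH _ _ (Ck_onS Cf) (dgv v)) (IH _ _ (dfv v) (Ck_onS Cg)).
by apply: (Ck_on_eq oU _ C) => x /H[_ ->].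
Qed.

(** Since [d(1/f) = - (1/f) (1/f) df], the induction hypothesis for [1/f] itself
    provides the missing factor. *)
Lemma Ck_onV V k (U : set V) (f : V -> R) : open U -> (forall x, U x -> f x != 0) ->
  Ck_on k U f -> Ck_on k U (fun x => (f x)^-1).
Proof.
move=> oU f0; elim: k => [|k IH].
  by move=> cf x Ux; apply: continuousV; [exact: f0|exact: cf].
move=> Cf; have [df dfv] := Cf; have Ci := IH (Ck_onS Cf).
split=> [x Ux|v].
  by apply: differentiableV; [exact: df|exact: f0].
have C := Ck_on_scale oU (Ck_on_scale oU
  (Ck_on_scale oU (@Ck_on_cst V R k U (-1)) Ci) Ci) (dfv v).
apply: (Ck_on_eq oU _ C) => x Ux.
apply: etrans (esym (congr1 (@^~ v) (diffV (df x Ux) (f0 x Ux)))) => /=.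
rewrite -![_ *: _]/(_ * _) mulN1r expr2 invfM mulNr; congr (- _ * _).
Qed.

Lemma Ck_on_postlin V W W' k (U : set V) (l : {linear W -> W'}) (f : V -> W) :
  open U -> continuous l -> Ck_on k U f -> Ck_on k U (fun x => l (f x)).
Proof.
move=> oU cl; elim: k f => [|k IH] f.
  by move=> cf x Ux; apply: continuous_comp; [exact: cf|exact: cl].
move=> [df dfv].
have H x : U x -> is_diff x (l \o f) (l \o 'd f x).
  move=> Ux; have dl : is_diff (f x) l l.
    by apply: DiffDef; [exact: linear_differentiable|exact: diff_lin].
  by have dfx := differentiableP (df x Ux); exact: is_diff_comp.
split=> [x /H[]//|v].
apply: (Ck_on_eq oU _ (IH _ (dfv v))) => x /H[_ E].
by rewrite -[RHS]/('d (l \o f) x v) E.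
Qed.

(** A map [i] with constant differential [l] turns the derivative of [f \o i]
    along [v] into the derivative of [f] along [l v], composed with [i] again;
    the induction thus never leaves compositions with [i]. Freezing one variable
    of a function of two variables is of this form. *)
Lemma Ck_on_preaff V V' W k (U : set V) (U' : set V') (i l : V -> V') (f : V' -> W) :
  open U -> (forall x, is_diff x i l) -> (forall x, U x -> U' (i x)) ->
  Ck_on k U' f -> Ck_on k U (fun x => f (i x)).
Proof.
move=> oU di iU; elim: k f => [|k IH] f.
  move=> cf x Ux; apply: continuous_comp; last exact/cf/iU.
  by apply: differentiable_continuous; have [] := di x.
move=> [df dfv].
have H x : U x -> is_diff x (f \o i) ('d f (i x) \o l).
  move=> Ux; have dfx := differentiableP (df _ (iU x Ux)); exact: is_diff_comp.
split=> [x /H[]//|v].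
apply: (Ck_on_eq oU _ (IH _ (dfv (l v)))) => x /H[_ E].
by rewrite -[RHS]/('d (f \o i) x v) E.
Qed.

Lemma smooth_on_sub V W (U U' : set V) (f : V -> W) :
  U `<=` U' -> smooth_on U' f -> smooth_on U f.
Proof. by move=> UU' sf k; exact/(Ck_on_sub UU')/sf. Qed.

Lemma smooth_on_eq V W (U : set V) (f g : V -> W) : open U ->
  (forall x, U x -> f x = g x) -> smooth_on U f -> smooth_on U g.
Proof. by move=> oU fg sf k; exact: Ck_on_eq (sf k). Qed.

Lemma smooth_on_differentiable V W (U : set V) (f : V -> W) (x : V) :
  smooth_on U f -> U x -> differentiable f x.
Proof. by move=> /(_ 1%N)[h _]; exact: h. Qed.

Lemma smooth_on_diff V W (U : set V) (f : V -> W) (v : V) :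
  smooth_on U f -> smooth_on U (fun x => 'd f x v).
Proof. by move=> sf k; have [_ h] := sf k.+1; exact: h. Qed.

Lemma smooth_on_cst V W (U : set V) (c : W) : smooth_on U (fun=> c).
Proof. by move=> k; exact: Ck_on_cst. Qed.

Lemma smooth_onD V W (U : set V) (f g : V -> W) : open U ->
  smooth_on U f -> smooth_on U g -> smooth_on U (fun x => f x + g x).
Proof. by move=> oU sf sg k; exact: Ck_onD. Qed.

Lemma smooth_on_scale V W (U : set V) (f : V -> R) (g : V -> W) : open U ->
  smooth_on U f -> smooth_on U g -> smooth_on U (fun x => f x *: g x).
Proof. by move=> oU sf sg k; exact: Ck_on_scale. Qed.

Lemma smooth_on_postlin V W W' (U : set V) (l : {linear W -> W'}) (f : V -> W) :
  open U -> continuous l -> smooth_on U f -> smooth_on U (fun x => l (f x)).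
Proof. by move=> oU cl sf k; exact: Ck_on_postlin. Qed.

Lemma smooth_on_sum V W (U : set V) (I : Type) (r : seq I) (F : I -> V -> W) :
  open U -> (forall i, smooth_on U (F i)) ->
  smooth_on U (fun x => \sum_(i <- r) F i x).
Proof.
move=> oU sF; elim: r => [|i r IH].
  under eq_fun do rewrite big_nil.
  exact: smooth_on_cst.
under eq_fun do rewrite big_cons.
exact: smooth_onD.
Qed.

Lemma smooth_onM V (U : set V) (f g : V -> R) : open U ->
  smooth_on U f -> smooth_on U g -> smooth_on U (fun x => f x * g x).
Proof. exact: smooth_on_scale. Qed.

Lemma smooth_on_prod V (U : set V) (I : Type) (r : seq I) (F : I -> V -> R) :
  open U -> (forall i, smooth_on U (F i)) ->
  smooth_on U (fun x => \prod_(i <- r) F i x).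
Proof.
move=> oU sF; elim: r => [|i r IH].
  under eq_fun do rewrite big_nil.
  exact: smooth_on_cst.
under eq_fun do rewrite big_cons.
exact: smooth_onM.
Qed.

Lemma smooth_on_det V (U : set V) n (M : V -> 'M[R]_n) : open U ->
  (forall i j, smooth_on U (fun x => M x i j)) -> smooth_on U (fun x => \det (M x)).
Proof.
move=> oU sM; apply: smooth_on_sum => // s; apply: smooth_onM => //.
  exact: smooth_on_cst.
exact: smooth_on_prod.
Qed.

(** Cramer's rule. *)
Lemma smooth_on_invmx V (U : set V) n (M : V -> 'M[R]_n) : open U ->
  (forall x, U x -> M x \in unitmx) ->
  (forall i j, smooth_on U (fun x => M x i j)) ->
  forall i j, smooth_on U (fun x => invmx (M x) i j).
Proof.
move=> oU uM sM i j.
have s : smooth_on U (fun x => (\det (M x))^-1 * \adj (M x) i j).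
  apply: smooth_onM => //.
    move=> k; apply: Ck_onV => //; last exact: smooth_on_det.
    by move=> x Ux; have := uM x Ux; rewrite unitmxE unitfE.
  under eq_fun do rewrite mxE.
  apply: smooth_onM => //; first exact: smooth_on_cst.
  apply: smooth_on_det => // k l.
  under eq_fun do rewrite !mxE.
  exact: sM.
by apply: (smooth_on_eq oU _ s) => x Ux; rewrite /invmx uM // [RHS]mxE.
Qed.

Lemma smooth_on_coord V (U : set V) m n (M : V -> 'M[R]_(m, n)) i j : open U ->
  smooth_on U M -> smooth_on U (fun x => M x i j).
Proof.
move=> oU; have lc : linear (fun N : 'M[R]_(m, n) => N i j : R).
  by move=> a A B; rewrite !mxE.
pose lM := GRing.isLinear.Build _ _ _ _ _ lc.
pose l : {linear 'M[R]_(m, n) -> R} := HB.pack (fun N : 'M[R]_(m, n) => N i j : R) lM.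
have cl : continuous l by move=> x; exact: coord_continuous.
by move=> sM; exact: (smooth_on_postlin oU cl sM).
Qed.

End Calculus.

(** * Change of charts and derivations on a manifold *)

Section Manifolds.
Context {R : realType} {E : normedModType R} {T : topologicalType}.
Variable A : charts E T.
Hypothesis mA : is_manifold A.

Lemma dom_self p : dom A p p. Proof. by have [_ _ /(_ p)[]] := mA. Qed.
Lemma dom_open p : open (dom A p). Proof. by have [_ _ /(_ p)[]] := mA. Qed.
Lemma cod_open p : open (cod A p). Proof. by have [_ _ /(_ p)[]] := mA. Qed.
Lemma phiK p q : dom A p q -> psi A p (phi A p q) = q.
Proof. by have [_ _ /(_ p)[_ _ _ h] _ _] := mA; exact: h. Qed.

Lemma cod_phi p q : dom A p q -> cod A p (phi A p q).
Proof. by exists q. Qed.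

Lemma dom_psi p x : cod A p x -> dom A p (psi A p x).
Proof. by move=> [q dq <-]; rewrite phiK. Qed.

Lemma psiK p x : cod A p x -> phi A p (psi A p x) = x.
Proof. by move=> [q dq <-]; rewrite phiK. Qed.

Lemma psi_continuous p x : cod A p x -> {for x, continuous (psi A p)}.
Proof.
have [_ _ _ /(_ p)[_ cp] _] := mA.
move: cp; rewrite continuous_open_subspace; last exact: cod_open.
by move=> cp cx; apply: cp; rewrite inE.
Qed.

Lemma open_psi_preimage (S : topologicalType) (f : T -> S) (O : set S) p :
  continuous f -> open O -> open (cod A p `&` (f \o psi A p) @^-1` O).
Proof.
move=> cf oO; rewrite openE => x [cx Ox].
apply: filterI; first exact: (open_nbhs_nbhs (conj (cod_open p) cx)).
have : {for x, continuous (f \o psi A p)}.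
  by apply: continuous_comp; [exact: psi_continuous|exact: cf].
by apply; exact: (open_nbhs_nbhs (conj oO Ox)).
Qed.

(** The first-order part of smoothness, which suffices for the chain rule in
    charts; the identity and the left translations have it. *)
Definition chart_differentiable (f : T -> T) : Prop :=
  continuous f /\ forall p q x, cod A p x -> dom A q (f (psi A p x)) ->
    differentiable (phi A q \o f \o psi A p) x.

Lemma chart_differentiable_id : chart_differentiable id.
Proof.
split=> [x|p q x cx dx]; first exact: cvg_id.
have [_ _ _ _ /(_ p q) s] := mA.
exact: (smooth_on_differentiable s).
Qed.

(** The chain rule through an intermediate chart [s]: close to [x] the map
    [psi A s \o phi A s] can be inserted after [f]. Taking [f] to be the
    identity gives the change of charts, taking [h] of the form
    [phi A r \o f'] composes tangent maps, and [h] may also be a real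
    function. *)
Lemma is_diff_chart_comp (W : normedModType R) (h : T -> W) (f : T -> T) q s x :
  chart_differentiable f -> cod A q x -> dom A s (f (psi A q x)) ->
  differentiable (h \o psi A s) (phi A s (f (psi A q x))) ->
  is_diff x (h \o f \o psi A q)
    ('d (h \o psi A s) (phi A s (f (psi A q x))) \o
     'd (phi A s \o f \o psi A q) x).
Proof.
move=> [cf df] cx dx /differentiableP dh.
have /differentiableP dfx := df q s x cx dx.
apply: (is_diff_near _ (is_diff_comp dfx dh)).
have oU := open_psi_preimage q cf (dom_open s).
have : \forall y \near x, (cod A q `&` (f \o psi A q) @^-1` dom A s) y.
  exact: (open_nbhs_nbhs (conj oU (conj cx dx))).
by apply: filterS => y [_ /= dy]; rewrite phiK.
Qed.

Lemma is_diff_phi_psi p x : cod A p x -> is_diff x (phi A p \o psi A p) id.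
Proof.
move=> cx; apply: (is_diff_near _ (is_diff_id x)).
have : \forall y \near x, cod A p y by exact: (open_nbhs_nbhs (conj (cod_open p) cx)).
by apply: filterS => y cy /=; rewrite psiK.
Qed.

Lemma local_rep_self (X : T -> E) p : local_rep A X p (phi A p p) = X p.
Proof.
rewrite /local_rep /= (phiK (dom_self p)).
by have [_ ->] := is_diff_phi_psi (cod_phi (dom_self p)).
Qed.

(** The opposite change of charts is a left inverse. *)
Lemma transition_inj p x (v : E) : cod A p x ->
  'd (phi A p \o psi A (psi A p x)) (phi A (psi A p x) (psi A p x)) v = 0 ->
  v = 0.
Proof.
move=> cx; set q := psi A p x => dv0.
have cq : cod A q (phi A q q) by exact: cod_phi (dom_self q).
have dpq : dom A p (psi A q (phi A q q)).
  by rewrite (phiK (dom_self q)); exact: dom_psi.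
have [_ E1] := is_diff_phi_psi cq.
have [|_ E2] := @is_diff_chart_comp _ (phi A q) id q p _ chart_differentiable_id cq dpq.
  apply: (chart_differentiable_id.2 p q); first exact: cod_phi.
  by rewrite /= (phiK dpq) (phiK (dom_self q)); exact: dom_self.
have : 'd (phi A q \o id \o psi A q) (phi A q q) v = v.
  by rewrite [LHS](congr1 (@^~ v) E1).
rewrite [LHS](congr1 (@^~ v) E2) /= => <-.
by rewrite [X in 'd _ _ X](_ : _ = 0) ?linear0.
Qed.

Lemma smooth_fun_differentiable (f : T -> R) p x :
  smooth_fun A f -> cod A p x -> differentiable (f \o psi A p) x.
Proof. by move=> sf cx; exact: (smooth_on_differentiable (sf p)). Qed.

(** At each point the derivation is computed in the chart around that point;
    smoothness of the result requires a formula in one fixed chart. *)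
Lemma vderiv_local (X : T -> E) (f : T -> R) p x :
  smooth_fun A f -> cod A p x ->
  vderiv A X f (psi A p x) = 'd (f \o psi A p) x (local_rep A X p x).
Proof.
move=> sf cx; rewrite /vderiv /local_rep; set q := psi A p x.
have cq : cod A q (phi A q q) by exact: cod_phi (dom_self q).
have qq : psi A q (phi A q q) = q := phiK (dom_self q).
have px : phi A p q = x by exact: psiK.
have dpq : dom A p (psi A q (phi A q q)) by rewrite qq; exact: dom_psi.
have [|_ E2] := @is_diff_chart_comp _ f id q p _ chart_differentiable_id cq dpq.
  by apply: smooth_fun_differentiable => //; exact: cod_phi.
by rewrite [LHS](congr1 (@^~ (X q)) E2) /= qq px.
Qed.

Lemma vderivD (X : T -> E) (f h : T -> R) p : smooth_fun A f -> smooth_fun A h ->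
  vderiv A X (fun q => f q + h q) p = vderiv A X f p + vderiv A X h p.
Proof.
move=> sf sh; have cp := cod_phi (dom_self p).
have df := smooth_fun_differentiable sf cp.
have dh := smooth_fun_differentiable sh cp.
exact: (congr1 (@^~ (X p)) (diffD df dh)).
Qed.

Lemma vderivM (X : T -> E) (f h : T -> R) p : smooth_fun A f -> smooth_fun A h ->
  vderiv A X (fun q => f q * h q) p = f p * vderiv A X h p + vderiv A X f p * h p.
Proof.
move=> sf sh; have cp := cod_phi (dom_self p).
have df := differentiableP (smooth_fun_differentiable sf cp).
have dh := differentiableP (smooth_fun_differentiable sh cp).
have [_ E1] := is_diff_scale df dh.
by rewrite [LHS](congr1 (@^~ (X p)) E1) /= phiK //; exact: dom_self.
Qed.

Lemma vderiv_cst (X : T -> E) (c : R) p : vderiv A X (fun=> c) p = 0.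
Proof. exact: (congr1 (@^~ (X p)) (diff_cst c (phi A p p))). Qed.

Lemma smooth_fun_cst (c : R) : smooth_fun A (fun=> c).
Proof. by move=> p; exact: smooth_on_cst. Qed.

Lemma smooth_funD (f h : T -> R) : smooth_fun A f -> smooth_fun A h ->
  smooth_fun A (fun q => f q + h q).
Proof. by move=> sf sh p; exact: (smooth_onD (cod_open p) (sf p) (sh p)). Qed.

Lemma smooth_funM (f h : T -> R) : smooth_fun A f -> smooth_fun A h ->
  smooth_fun A (fun q => f q * h q).
Proof. by move=> sf sh p; exact: (smooth_onM (cod_open p) (sf p) (sh p)). Qed.

Lemma smooth_fun_sum (I : Type) (r : seq I) (F : I -> T -> R) :
  (forall i, smooth_fun A (F i)) -> smooth_fun A (fun q => \sum_(i <- r) F i q).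
Proof.
by move=> sF p; exact: (smooth_on_sum r (cod_open p) (fun i => sF i p)).
Qed.

Lemma vderiv_sum (X : T -> E) (I : Type) (r : seq I) (F : I -> T -> R) p :
  (forall i, smooth_fun A (F i)) ->
  vderiv A X (fun q => \sum_(i <- r) F i q) p = \sum_(i <- r) vderiv A X (F i) p.
Proof.
move=> sF; elim: r => [|i r IH].
  by under eq_fun do rewrite big_nil; rewrite big_nil vderiv_cst.
under eq_fun do rewrite big_cons.
by rewrite big_cons vderivD ?IH //; exact: smooth_fun_sum.
Qed.

Lemma vderiv_linear (f : T -> R) p (X Y Z : T -> E) (a b : R) :
  Z p = a *: X p + b *: Y p ->
  vderiv A Z f p = a * vderiv A X f p + b * vderiv A Y f p.
Proof. by move=> e; rewrite /vderiv e linearD !linearZ. Qed.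

End Manifolds.

Lemma smooth_fun_vderiv (R : realType) n (T : topologicalType)
    (A : charts 'rV[R]_n T) (X : T -> 'rV[R]_n) (f : T -> R) : is_manifold A ->
  smooth_vfield A X -> smooth_fun A f -> smooth_fun A (vderiv A X f).
Proof.
move=> mA sX sf p; have oc := cod_open mA p.
have s : smooth_on (cod A p) (fun x => \sum_(i < n)
    local_rep A X p x 0 i * 'd (f \o psi A p) x (delta_mx 0 i)).
  apply: smooth_on_sum => // i; apply: smooth_onM => //.
    exact: (smooth_on_coord 0 i oc (sX p)).
  exact: smooth_on_diff (sf p).
apply: (smooth_on_eq oc _ s) => x cx /=.
rewrite vderiv_local // [X in 'd _ _ X]row_sum_delta linear_sum.
by apply: eq_bigr => i _; rewrite linearZ.
Qed.

(** * The left-invariant frame of a Lie group *)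

Section LeftInvariantFrame.
Context {R : realType} {n : nat} {G : topologicalGroupType}.
Variable A : charts 'rV[R]_n G.
Hypothesis lieG : is_lie_group A.

Let mA : is_manifold A. Proof. by have [] := lieG. Qed.

Definition left_mul (a : G) : G -> G := fun x => (a * x)%g.

Lemma left_mul_continuous a : continuous (left_mul a).
Proof.
have [_ [cm _] _] := lieG => x.
apply: (@continuous_comp _ _ _ (fun y : G => (a, y)) (fun z : G * G => (z.1 * z.2)%g)).
  by apply: cvg_pair; [exact: cvg_cst|exact: cvg_id].
exact: cm.
Qed.

Definition chart_mul p r q : 'rV[R]_n * 'rV[R]_n -> 'rV[R]_n :=
  phi A q \o (fun z : G * G => (z.1 * z.2)%g) \o psi (prod_charts A A) (p, r).

Lemma smooth_chart_mul p r q :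
  smooth_on [set z | [/\ cod A p z.1, cod A r z.2 &
                         dom A q (psi A p z.1 * psi A r z.2)%g]]
            (chart_mul p r q).
Proof.
have [_ [_ /(_ (p, r) q) sm] _] := lieG.
apply: smooth_on_sub sm => -[x y] [/= cx cy dz]; split => //.
exists (psi A p x, psi A r y); first by split; exact: dom_psi.
by rewrite /= !psiK.
Qed.

Lemma is_diff_pairl (x y : 'rV[R]_n) :
  is_diff y (fun z : 'rV[R]_n => (x, z)) (fun v => (0, v)).
Proof. exact: (is_diff_pair (is_diff_cst x y) (is_diff_id y)). Qed.

Lemma is_diff_pairr (x y : 'rV[R]_n) :
  is_diff x (fun z : 'rV[R]_n => (z, y)) (fun v => (v, 0)).
Proof. exact: (is_diff_pair (is_diff_id x) (is_diff_cst y x)). Qed.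

(** A left translation is the group law with its first variable frozen, here at
    the point of coordinates [phi A p a]. *)
Lemma is_diff_chart_left_mul a p r q x : dom A p a -> cod A r x ->
  dom A q (a * psi A r x)%g ->
  is_diff x (phi A q \o left_mul a \o psi A r)
    (fun v => 'd (chart_mul p r q) (phi A p a, x) (0, v)).
Proof.
move=> da cx dx.
have /differentiableP dm : differentiable (chart_mul p r q) (phi A p a, x).
  apply: (smooth_on_differentiable (smooth_chart_mul p r q)); split => //=.
    exact: cod_phi.
  by rewrite (phiK mA da).
rewrite (_ : _ \o _ = chart_mul p r q \o (fun z => (phi A p a, z))).
  exact: (is_diff_comp (is_diff_pairl (phi A p a) x) dm).
by apply/funext => y; rewrite /chart_mul /= (phiK mA da).
Qed.

Lemma chart_differentiable_left_mul a : chart_differentiable A (left_mul a).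
Proof.
split=> [|p q x cx dx]; first exact: left_mul_continuous.
by have [] := is_diff_chart_left_mul (dom_self mA a) cx dx.
Qed.

(** The only possible left-invariant field with value [v] at the identity. *)
Definition left_field (v : 'rV[R]_n) (a : G) : 'rV[R]_n :=
  tangent_map A (left_mul a) 1%g v.

(** The value at [a] is expressed in the chart around [a]; moving it to a
    chart [p] that does not vary with [a] gives the tangent map of the
    translation from the chart at the identity to [p]. *)
Lemma left_field_chart v a p : dom A p a ->
  'd (phi A p \o psi A a) (phi A a a) (left_field v a) =
  'd (phi A p \o left_mul a \o psi A 1%g) (phi A 1%g 1%g) v.
Proof.
move=> da; rewrite /left_field /tangent_map.
have c1 := cod_phi (dom_self mA 1%g).
have e1 : left_mul a (psi A 1%g (phi A 1%g 1%g)) = a.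
  by rewrite (phiK mA) ?/left_mul ?mulg1 //; exact: dom_self.
have aa : left_mul a 1%g = a by rewrite /left_mul mulg1.
have := @is_diff_chart_comp _ _ _ _ mA _ (phi A p) (left_mul a) 1%g a _
  (chart_differentiable_left_mul a) c1.
rewrite e1 => /(_ (dom_self mA a)) [|_ E].
  apply: ((chart_differentiable_id mA).2 a p); first exact/cod_phi/dom_self.
  by rewrite (phiK mA) //; exact: dom_self.
by rewrite aa [RHS](congr1 (@^~ v) E).
Qed.

(** In the chart [p] the field is the partial derivative of the group law along
    [(0, v)] at the identity, hence smooth in the other variable. *)
Lemma smooth_left_field v : smooth_vfield A (left_field v).
Proof.
move=> p.
have s : smooth_on (cod A p)
    (fun x => 'd (chart_mul p 1%g p) (x, phi A 1%g 1%g) (0, v)).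
  move=> k.
  apply: (Ck_on_preaff (cod_open mA p) (is_diff_pairr ^~ (phi A 1%g 1%g)) _
            (smooth_on_diff (0, v) (smooth_chart_mul p 1%g p) k)).
  move=> x cx; split => //=; first exact/cod_phi/dom_self.
  by rewrite (phiK mA (dom_self mA _)) mulg1; exact: dom_psi.
apply: (smooth_on_eq (cod_open mA p) _ s) => x cx.
have dx := dom_psi mA cx.
rewrite /local_rep /= left_field_chart //.
have c1 := cod_phi (dom_self mA 1%g).
have [|_ ->] := @is_diff_chart_left_mul (psi A p x) p 1%g p _ dx c1.
  by rewrite (phiK mA (dom_self mA _)) mulg1.
by rewrite (psiK mA cx).
Qed.

(** Translation by [a * p] is the composite of two translations. *)
Lemma left_invariant_left_field v : left_invariant A (left_field v).
Proof.
split=> [|a p]; first exact: smooth_left_field.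
have c1 := cod_phi (dom_self mA 1%g).
have e1 : left_mul p (psi A 1%g (phi A 1%g 1%g)) = p.
  by rewrite (phiK mA) ?/left_mul ?mulg1 //; exact: dom_self.
have := @is_diff_chart_comp _ _ _ _ mA _ (phi A (a * p)%g \o left_mul a)
  (left_mul p) 1%g p _ (chart_differentiable_left_mul p) c1.
rewrite e1 => /(_ (dom_self mA p)) [|_ E].
  apply: ((chart_differentiable_left_mul a).2 p); first exact/cod_phi/dom_self.
  by rewrite (phiK mA) //; exact: dom_self.
rewrite /left_field /tangent_map -/(left_mul a).
have ap : left_mul (a * p)%g = left_mul a \o left_mul p.
  by apply/funext => x; rewrite /left_mul /= mulgA.
have a1 : left_mul (a * p)%g 1%g = (a * p)%g by rewrite /left_mul mulg1.
have p1 : left_mul p 1%g = p by rewrite /left_mul mulg1.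
rewrite a1 ap p1 -/(left_mul a p).
exact: (congr1 (@^~ v) E).
Qed.

Lemma left_field1 v : left_field v 1%g = v.
Proof.
rewrite /left_field /tangent_map /left_mul mulg1.
have -> : (fun x : G => (1 * x)%g) = id by apply/funext => x; rewrite mul1g.
have [_ E] := is_diff_phi_psi mA (cod_phi (dom_self mA 1%g)).
exact: (congr1 (@^~ v) E).
Qed.

Context {g : lieAlgebraType R}.
Variable L : g -> G -> 'rV[R]_n.
Hypothesis LA : is_lie_algebra_of A L.

(** The map [X |-> L X p], evaluation at [p], is linear by a hypothesis on [L] and
    not by a declared structure; the lemmas named after ev spell out the
    consequences. *)
Lemma ev_linear p a X Y : L (a *: X + Y) p = a *: L X p + L Y p.
Proof. by have [h _ _ _] := LA; exact: h. Qed.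

Lemma ev0 p : L 0 p = 0.
Proof.
apply: (addrI (L 0 p)); rewrite addr0.
by rewrite -{1}[L 0 p]scale1r -ev_linear scaler0 addr0.
Qed.

Lemma evD p X Y : L (X + Y) p = L X p + L Y p.
Proof. by rewrite -{1}[X]scale1r ev_linear scale1r. Qed.

Lemma evZ p a X : L (a *: X) p = a *: L X p.
Proof. by rewrite -{1}[a *: X]addr0 ev_linear ev0 addr0. Qed.

Lemma evB p X Y : L (X - Y) p = L X p - L Y p.
Proof. by rewrite -[- Y]scaleN1r evD evZ scaleN1r. Qed.

Lemma ev_sum p (I : Type) (r : seq I) (F : I -> g) :
  L (\sum_(i <- r) F i) p = \sum_(i <- r) L (F i) p.
Proof. by elim/big_ind2: _ => [|x u y v <- <-|//]; rewrite ?ev0 ?evD. Qed.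

Lemma ev_left_invariant X : left_invariant A (L X).
Proof. by have [_ _ h _] := LA; apply/h; exists X. Qed.

(** A left-invariant field that vanishes at [p] is the translate of 0
    everywhere. *)
Lemma ev_inj p X : L X p = 0 -> X = 0.
Proof.
move=> X0; have [_ injL _ _] := LA; apply: injL; apply/funext => a.
have [_ /(_ (a * p^-1)%g p)] := ev_left_invariant X.
rewrite -mulgA mulVg mulg1 X0 => ->.
by rewrite ev0 /tangent_map linear0.
Qed.

Lemma frame_vec_subproof i : exists X : g, L X = left_field (delta_mx 0 i).
Proof. by have [_ _ h _] := LA; apply/h; exact: left_invariant_left_field. Qed.

(** A basis of [g] indexed by [n]: the fields taking the values of the standard
    basis at the identity. It avoids comparing the dimension of [g] with [n]. *)
Definition frame_vec (i : 'I_n) : g := sval (cid (frame_vec_subproof i)).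

Definition frame_coord (i : 'I_n) (X : g) : R := L X 1%g 0 i.

Lemma ev_frame_vec i : L (frame_vec i) 1%g = delta_mx 0 i.
Proof. by rewrite /frame_vec; case: cid => X /= ->; exact: left_field1. Qed.

Lemma frame_expand X : X = \sum_i frame_coord i X *: frame_vec i.
Proof.
apply/eqP; rewrite -subr_eq0; apply/eqP; apply: (@ev_inj 1%g).
rewrite evB ev_sum {1}(row_sum_delta (L X 1%g)) -sumrB big1 // => i _.
by rewrite evZ ev_frame_vec subrr.
Qed.

Lemma frame_coord_linear i : scalar (frame_coord i).
Proof. by move=> a X Y; rewrite /frame_coord ev_linear !mxE. Qed.

Lemma local_rep_frame (X : G -> 'rV[R]_n) (xi : G -> g) p x :
  (forall q, X q = L (xi q) q) ->
  local_rep A X p x =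
  \sum_i frame_coord i (xi (psi A p x)) *: local_rep A (L (frame_vec i)) p x.
Proof.
move=> e; rewrite /local_rep /= e {1}(frame_expand (xi (psi A p x))) ev_sum linear_sum.
by apply: eq_bigr => i _; rewrite evZ linearZ.
Qed.

Definition frame_mx p x : 'M[R]_n := \matrix_(i < n) local_rep A (L (frame_vec i)) p x.

Lemma smooth_ev X : smooth_vfield A (L X).
Proof. by have [] := ev_left_invariant X. Qed.

Lemma smooth_frame_mx p i j : smooth_on (cod A p) (fun x => frame_mx p x i j).
Proof.
under eq_fun do rewrite mxE.
exact: (smooth_on_coord 0 j (cod_open mA p) (smooth_ev (frame_vec i) p)).
Qed.

(** A relation between the rows is an element of [g] whose field vanishes at a
    point, hence vanishes by [ev_inj]. *)
Lemma frame_mx_unit p x : cod A p x -> frame_mx p x \in unitmx.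
Proof.
move=> cx; rewrite -row_free_unit; apply: inj_row_free => u u0.
set X := \sum_i u 0 i *: frame_vec i.
have cfX i : frame_coord i X = u 0 i.
  rewrite /frame_coord /X ev_sum [in RHS](row_sum_delta u) !summxE.
  by apply: eq_bigr => k _; rewrite evZ ev_frame_vec.
suff X0 : X = 0 by apply/rowP => i; rewrite -cfX X0 /frame_coord ev0 !mxE.
apply: (@ev_inj (psi A p x)); apply: (transition_inj mA cx).
rewrite -[LHS]/(local_rep A (L X) p x) (@local_rep_frame _ (fun=> X)) //.
rewrite mulmx_sum_row in u0; rewrite -[RHS]u0; apply: eq_bigr => i _.
by rewrite cfX rowK.
Qed.

Lemma ev_surj p v : exists X, L X p = v.
Proof.
have cp := cod_phi (dom_self mA p).
pose u := v *m invmx (frame_mx p (phi A p p)).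
exists (\sum_i u 0 i *: frame_vec i); rewrite ev_sum.
rewrite -[v](mulmxKV (frame_mx_unit cp)) -/u mulmx_sum_row.
by apply: eq_bigr => i _; rewrite evZ rowK (local_rep_self mA).
Qed.

Lemma left_translateK p v : L (left_translate L p v) p = v.
Proof.
rewrite /left_translate; case: xgetP => // /(_ _)h.
by have [X /h] := ev_surj p v.
Qed.

Lemma evK p X : left_translate L p (L X p) = X.
Proof.
apply/eqP; rewrite -subr_eq0; apply/eqP; apply: (@ev_inj p).
by rewrite evB left_translateK subrr.
Qed.

(** The Maurer-Cartan form evaluated on a vector field: it identifies vector
    fields on the group with functions with values in [g]. *)
Definition maurer_cartan (X : G -> 'rV[R]_n) (q : G) : g := left_translate L q (X q).

Lemma maurer_cartanK X q : L (maurer_cartan X q) q = X q.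
Proof. exact: left_translateK. Qed.

Definition smooth_lie_map (xi : G -> g) : Prop :=
  forall i, smooth_fun A (fun q => frame_coord i (xi q)).

Lemma smooth_vfield_lie (xi : G -> g) : smooth_lie_map xi ->
  smooth_vfield A (fun q => L (xi q) q).
Proof.
move=> sxi p; have oc := cod_open mA p.
have s : smooth_on (cod A p) (fun x =>
    \sum_i frame_coord i (xi (psi A p x)) *: local_rep A (L (frame_vec i)) p x).
  apply: smooth_on_sum => // i; apply: smooth_on_scale => //; first exact: sxi.
  exact: smooth_ev.
by apply: (smooth_on_eq oc _ s) => x cx; rewrite (@local_rep_frame _ xi).
Qed.

(** The coordinates solve a linear system whose invertible matrix [frame_mx] is
    smooth, so they are smooth by Cramer's rule. *)
Lemma smooth_maurer_cartan X : smooth_vfield A X -> smooth_lie_map (maurer_cartan X).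
Proof.
move=> sX j p; have oc := cod_open mA p.
have s : smooth_on (cod A p) (fun x =>
    \sum_i local_rep A X p x 0 i * invmx (frame_mx p x) i j).
  apply: smooth_on_sum => // i; apply: smooth_onM => //.
    exact: (smooth_on_coord 0 i oc (sX p)).
  by apply: smooth_on_invmx => //; [exact: frame_mx_unit|exact: smooth_frame_mx].
apply: (smooth_on_eq oc _ s) => x cx /=.
have e : local_rep A X p x =
    (\row_i frame_coord i (maurer_cartan X (psi A p x))) *m frame_mx p x.
  rewrite (@local_rep_frame X (maurer_cartan X)); last first.
    by move=> q; rewrite maurer_cartanK.
  by rewrite mulmx_sum_row; apply: eq_bigr => i _; rewrite mxE rowK.
have -> : \sum_i local_rep A X p x 0 i * invmx (frame_mx p x) i j =
    (local_rep A X p x *m invmx (frame_mx p x)) 0 j by rewrite mxE.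
by rewrite e mulmxK ?mxE //; exact: frame_mx_unit.
Qed.

End LeftInvariantFrame.

(** * Linear algebra of abelian hypercomplex Lie algebras *)

Section InnerProducts.
Context {R : realType} {V : vectType R}.
Variable b : V -> V -> R.
Hypothesis ib : inner_product b.

Lemma inner_productC X Y : b X Y = b Y X.
Proof. by have [_ h _] := ib. Qed.

Lemma inner_product_scalarl Y : scalar (b ^~ Y).
Proof. by have [h _ _] := ib => a X Z; exact: h. Qed.

Lemma inner_product_scalarr X : scalar (b X).
Proof. by move=> a Y Z; rewrite !(inner_productC X) inner_product_scalarl. Qed.

Lemma inner_product_eq0 X : b X X = 0 -> X = 0.
Proof.
have [_ _ pos] := ib => X0; apply/eqP; apply: contraTT isT => /pos.
by rewrite X0 ltxx.
Qed.

Lemma inner_product_ge0 X : 0 <= b X X.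
Proof.
have [_ _ pos] := ib; have [->|/pos/ltW//] := eqVneq X 0.
have := inner_product_scalarl 0 1 0 0.
rewrite scaler0 addr0 mul1r => /eqP.
by rewrite -subr_eq0 opprD addNKr oppr_eq0 => /eqP ->.
Qed.

End InnerProducts.

Section ScalarMaps.
Context {R : realType} {V : lmodType R}.
Variable f : V -> R.
Hypothesis lf : scalar f.

Lemma scalar0 : f 0 = 0.
Proof. by have := lf 1 0 0; rewrite scaler0 addr0 mul1r; lra. Qed.

Lemma scalarD X Y : f (X + Y) = f X + f Y.
Proof. by have := lf 1 X Y; rewrite scale1r mul1r. Qed.

Lemma scalarZ a X : f (a *: X) = a * f X.
Proof. by rewrite -[a *: X]addr0 lf scalar0 addr0. Qed.

Lemma scalarN X : f (- X) = - f X.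
Proof. by rewrite -scaleN1r scalarZ mulN1r. Qed.

Lemma scalarB X Y : f (X - Y) = f X - f Y.
Proof. by rewrite scalarD scalarN. Qed.

Lemma scalar_sum (I : Type) (r : seq I) (F : I -> V) :
  f (\sum_(i <- r) F i) = \sum_(i <- r) f (F i).
Proof. by elim/big_ind2: _ => [|x u y v <- <-|//]; rewrite ?scalar0 ?scalarD. Qed.

End ScalarMaps.

(** The Gram matrix of a basis is invertible because the form is definite. *)
Lemma inner_product_riesz (R : realType) (V : vectType R) (b : V -> V -> R)
    (f : V -> R) : inner_product b -> scalar f ->
  exists X, forall Y, b X Y = f Y.
Proof.
move=> ib lf; pose e i := (vbasis {:V})`_i.
pose Gm : 'M[R]_(\dim {:V}) := \matrix_(i, j) b (e i) (e j).
have expand X : X = \sum_(i < \dim {:V}) coord (vbasis {:V}) i X *: e i.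
  by rewrite -coord_vbasis // memvf.
have bl (u : 'rV[R]_(\dim {:V})) (j : 'I_(\dim {:V})) :
    b (\sum_i u 0 i *: e i) (e j) = (u *m Gm) 0 j.
  rewrite (scalar_sum (inner_product_scalarl ib _)) mxE; apply: eq_bigr => i _.
  by rewrite (scalarZ (inner_product_scalarl ib _)) mxE.
have uG : Gm \in unitmx.
  rewrite -row_free_unit; apply: inj_row_free => u u0.
  pose X := \sum_i u 0 i *: e i.
  have X0 : X = 0.
    apply: (inner_product_eq0 ib); rewrite {2}(expand X).
    rewrite (scalar_sum (inner_product_scalarr ib _)) big1 // => i _.
    by rewrite (scalarZ (inner_product_scalarr ib _)) bl u0 mxE mulr0.
  apply/rowP => i; rewrite mxE.
  have := coord_sum_free (fun i => u 0 i) i (basis_free (vbasisP {:V})).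
  by rewrite -/X X0 linear0.
pose u := (\row_j f (e j)) *m invmx Gm.
exists (\sum_i u 0 i *: e i) => Y.
rewrite (expand Y) (scalar_sum (inner_product_scalarr ib _)) (scalar_sum lf).
apply: eq_bigr => j _.
by rewrite (scalarZ (inner_product_scalarr ib _)) (scalarZ lf) bl mulmxKV // mxE.
Qed.

Section LieAlgebras.
Context {R : realType} {g : lieAlgebraType R}.
Implicit Types X Y Z : g.

Lemma lieC X Y : lie X Y = - lie Y X.
Proof.
have addl (x y z : g) : lie (x + y) z = lie x z + lie y z.
  by have := lie_linearl 1 x y z; rewrite !scale1r.
have addr (x y z : g) : lie x (y + z) = lie x y + lie x z.
  by have := lie_linearr 1 x y z; rewrite !scale1r.
have := lie_alternating (X + Y).
rewrite addl !addr !lie_alternating add0r addr0 => /eqP.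
by rewrite addr_eq0 => /eqP.
Qed.

Lemma lie0r X : lie X 0 = 0.
Proof.
have := lie_linearr 1 X 0 0; rewrite !scale1r addr0 => /eqP.
by rewrite -subr_eq0 opprD addNKr oppr_eq0 => /eqP.
Qed.

Lemma lieNr X Y : lie X (- Y) = - lie X Y.
Proof.
by have := lie_linearr (-1) X Y 0; rewrite !scaleN1r lie0r !addr0.
Qed.

Lemma lieNl X Y : lie (- X) Y = - lie X Y.
Proof. by rewrite lieC lieNr -lieC. Qed.

Variable b : g -> g -> R.
Hypothesis ib : inner_product b.

(** The torsion form of the Bismut connection of an abelian hypercomplex
    structure, on left-invariant fields. *)
Definition torsion3 X Y Z : R :=
  - (b X (lie Y Z) + b Y (lie Z X) + b Z (lie X Y)).

(** The Chevalley-Eilenberg differential of [torsion3], which is the exterior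
    derivative on left-invariant fields. *)
Definition dtorsion3 X0 X1 X2 X3 : R :=
  - torsion3 (lie X0 X1) X2 X3 + torsion3 (lie X0 X2) X1 X3
  - torsion3 (lie X0 X3) X1 X2 - torsion3 (lie X1 X2) X0 X3
  + torsion3 (lie X1 X3) X0 X2 - torsion3 (lie X2 X3) X0 X1.

(** Expanding the left side, the terms [b Xi (lie Xj (lie Xk Xl))] with a given
    [Xi] add up to the Jacobi identity of the three other vectors. Only the
    products of two brackets remain, each appearing twice. *)
Lemma dtorsion3E X0 X1 X2 X3 : dtorsion3 X0 X1 X2 X3 =
  2 * (b (lie X0 X1) (lie X2 X3) - b (lie X0 X2) (lie X1 X3)
       + b (lie X0 X3) (lie X1 X2)).
Proof.
have jac X Y Z W : b W (lie X (lie Y Z)) + b W (lie Y (lie Z X)) +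
    b W (lie Z (lie X Y)) = 0.
  have lb := inner_product_scalarr ib W.
  by rewrite -!(scalarD lb) lie_jacobi (scalar0 lb).
have bN X Y : b X (- Y) = - b X Y := scalarN (inner_product_scalarr ib X) Y.
have skew W X Y Z : b W (lie (lie X Y) Z) = - b W (lie Z (lie X Y)).
  by rewrite lieC bN.
have skew2 W X Y Z : b W (lie Z (lie X Y)) = - b W (lie Z (lie Y X)).
  by rewrite (lieC X) lieNr bN.
have := jac X1 X2 X3 X0; have := jac X2 X3 X0 X1.
have := jac X3 X0 X1 X2; have := jac X0 X1 X2 X3.
rewrite /dtorsion3 /torsion3 !skew.
rewrite !(skew2 _ X2 X0) !(skew2 _ X3 X0) !(skew2 _ X3 X1).
rewrite !(inner_productC ib (lie X2 X3)) !(inner_productC ib (lie X1 X3)).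
rewrite !(inner_productC ib (lie X1 X2)).
by lra.
Qed.

Lemma lie_linear_l Y : linear (fun X => lie X Y).
Proof. by move=> a X Z; rewrite lie_linearl. Qed.

Lemma lie_linear_r X : linear (lie X).
Proof. by move=> a Y Z; rewrite lie_linearr. Qed.

Lemma inner_product_inj X Y : (forall Z, b X Z = b Y Z) -> X = Y.
Proof.
move=> e; apply/eqP; rewrite -subr_eq0; apply/eqP; apply: (inner_product_eq0 ib).
by rewrite (scalarB (inner_product_scalarl ib _)) e subrr.
Qed.

Lemma torsion3_linear Y Z : scalar (fun X => torsion3 X Y Z).
Proof.
move=> a X X'; rewrite /torsion3 lie_linearl lie_linearr.
by rewrite (inner_product_scalarl ib) !(inner_product_scalarr ib); ring.
Qed.

Lemma torsion3_skew X Y Z :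
  torsion3 Y X Z = - torsion3 X Y Z /\ torsion3 X Z Y = - torsion3 X Y Z.
Proof.
have bN X' Y' : b X' (- Y') = - b X' Y' := scalarN (inner_product_scalarr ib X') Y'.
by rewrite /torsion3 (lieC X Z) (lieC Z Y) (lieC Y X) !bN; split; ring.
Qed.

(** [B] is the difference between the Bismut connection and the flat connection
    that makes left-invariant fields parallel. The formula is forced: adding half
    of [torsion3] to the Koszul formula leaves only the bracket term displayed
    here, which is skew in [Y] and [Z]. *)
Lemma exists_bismut_tensor : exists B : g -> g -> g,
  [/\ forall Y, linear (B ^~ Y), forall X, linear (B X)
    & forall X Y Z, b (B X Y) Z = - b X (lie Y Z)].
Proof.
have bl := inner_product_scalarl ib; have br := inner_product_scalarr ib.
have ex (XY : g * g) : exists W, forall Z, b W Z = - b XY.1 (lie XY.2 Z).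
  apply: inner_product_riesz => // a Y Z.
  by rewrite lie_linearr br; ring.
have [B BE] := choice ex; exists (fun X Y => B (X, Y)).
split=> [Y a X X'|X a Y Y'|X Y Z]; last exact: BE.
  by apply: inner_product_inj => Z; rewrite bl !BE /= bl; ring.
by apply: inner_product_inj => Z; rewrite bl !BE /= lie_linearl br; ring.
Qed.

Variable J : 'I_3 -> 'End(g).
Hypothesis aJ : abelian_hypercomplex_lie J.

Lemma lie_J_swap i X Y : lie (J i X) Y = - lie X (J i Y).
Proof.
have [[[JJ _] _] ab] := aJ.
have e : J i (J i Y) = - Y := JJ i Y.
by rewrite -[Y in LHS]opprK -e lieNr ab.
Qed.

Hypothesis bJ : forall i X Y, b (J i X) (J i Y) = b X Y.

(** For an abelian structure [J i] is skew for the bracket, as it is for [b]. *)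
Lemma bismut_tensor_J (B : g -> g -> g) :
  (forall X Y Z, b (B X Y) Z = - b X (lie Y Z)) ->
  forall i X Y, B X (J i Y) = J i (B X Y).
Proof.
move=> BE i X Y; apply: inner_product_inj => Z.
have [[[JJ _] _] _] := aJ.
have bN X' Y' : b X' (- Y') = - b X' Y' := scalarN (inner_product_scalarr ib X') Y'.
have e : J i (J i (B X Y)) = - B X Y := JJ i _.
rewrite -(bJ i (J i _)) e (scalarN (inner_product_scalarl ib _)) !BE lie_J_swap bN.
by rewrite opprK.
Qed.

(** Evaluating [dtorsion3] on [X, JX, Y, JY], where [J] stands for [J 0], gives
    the identity [key]. For [Y] the image of [X] under a second complex structure
    anticommuting with [J], the left side of [key] becomes minus the square norm
    of [lie X (JX)], so that bracket vanishes. Then the left side of [key] is 0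
    for all [X] and [Y], and so are the squares on its right side. *)
Lemma closed_torsion3_lie0 :
  (forall X0 X1 X2 X3, dtorsion3 X0 X1 X2 X3 = 0) -> forall X Y, lie X Y = 0.
Proof.
move=> d0.
have [[[JJ JK] _] ab] := aJ.
have bN X Y : b X (- Y) = - b X Y := scalarN (inner_product_scalarr ib X) Y.
have key X Y : b (lie X (J 0 X)) (lie Y (J 0 Y)) =
    b (lie X Y) (lie X Y) + b (lie X (J 0 Y)) (lie X (J 0 Y)).
  have := d0 X (J 0 X) Y (J 0 Y); rewrite dtorsion3E.
  by rewrite ab lie_J_swap bN; lra.
have XJX X : lie X (J 0 X) = 0.
  apply: (inner_product_eq0 ib).
  (* for this choice the two brackets on the left side of key are opposite *)
  have := key X (J 1 X); have [-> e10] := JK X.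
  have -> : lie (J 1 X) (J 2 X) = - lie X (J 0 X).
    by rewrite -[J 2 X]opprK -e10 lieNr ab.
  rewrite bN => e.
  have := inner_product_ge0 ib (lie X (J 0 X)).
  have := inner_product_ge0 ib (lie X (J 1 X)).
  by have := inner_product_ge0 ib (lie X (J 2 X)); lra.
move=> X Y; apply: (inner_product_eq0 ib).
have := key X Y; rewrite !XJX.
rewrite (scalar0 (inner_product_scalarr ib _)).
have := inner_product_ge0 ib (lie X Y).
by have := inner_product_ge0 ib (lie X (J 0 Y)); lra.
Qed.

End LieAlgebras.

(** The difference between two metric connections with skew torsion that both
    preserve [J]. The skewness assumptions make [d] a 3-form, so invariance under
    [J] in two slots holds for every pair of slots; applying it to the slots 2, 3,
    then 1, 2, then 1, 3 yields [d = - d]. *)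
Lemma skew_tensor_eq0 (R : realType) (V : zmodType) (J : V -> V)
    (d : V -> V -> V -> R) :
  (forall X, J (J X) = - X) ->
  (forall X Y Z, d X (- Y) Z = - d X Y Z) ->
  (forall X Y Z, d X Y Z = - d X Z Y) ->
  (forall X Y Z, d X Z Y - d Z X Y = - (d Y Z X - d Z Y X)) ->
  (forall X Y Z, d X (J Y) (J Z) = d X Y Z) ->
  forall X Y Z, d X Y Z = 0.
Proof.
move=> JJ dN skew skewc dJ X Y Z.
have cyc X' Y' Z' : d X' Y' Z' = d Y' Z' X'.
  by have := skewc X' Y' Z'; have := skew Z' X' Y'; have := skew X' Y' Z'; lra.
have dJl X' Y' Z' : d (J X') (J Y') Z' = d X' Y' Z'.
  by rewrite -cyc dJ cyc.
have := dJl X (J Y) (J Z); rewrite JJ dN dJ cyc dJ -cyc.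
by lra.
Qed.

(** * Vector fields as functions with values in the Lie algebra *)

Section Derivations.
Context {R : realType} {n : nat} {G : topologicalGroupType}.
Variable A : charts 'rV[R]_n G.
Hypothesis lieG : is_lie_group A.
Context {g : lieAlgebraType R}.
Variable L : g -> G -> 'rV[R]_n.
Hypothesis LA : is_lie_algebra_of A L.

Let mA : is_manifold A. Proof. by have [] := lieG. Qed.
Local Notation frame := (frame_vec lieG LA).
Local Notation cf := (frame_coord L).
Local Notation mc := (maurer_cartan L).
Local Notation smooth_lie := (smooth_lie_map A L).

Lemma frame_coord_vec i j : cf i (frame j) = (i == j)%:R.
Proof. by rewrite /frame_coord ev_frame_vec mxE eqxx. Qed.

Lemma frame_coord_inj X Y : (forall i, cf i X = cf i Y) -> X = Y.
Proof.
move=> e; rewrite (frame_expand lieG LA X) (frame_expand lieG LA Y).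
by apply: eq_bigr => i _; rewrite e.
Qed.

Lemma frame_coord_sum i (F : 'I_n -> R) : cf i (\sum_j F j *: frame j) = F i.
Proof.
rewrite (scalar_sum (frame_coord_linear LA i)) (bigD1 i) //= big1 => [|j ji].
  by rewrite (scalarZ (frame_coord_linear LA i)) frame_coord_vec eqxx mulr1 addr0.
by rewrite (scalarZ (frame_coord_linear LA i)) frame_coord_vec eq_sym (negbTE ji) mulr0.
Qed.

Lemma scalar_expand (f : g -> R) X : scalar f -> f X = \sum_i cf i X * f (frame i).
Proof.
move=> lf; rewrite {1}(frame_expand lieG LA X) (scalar_sum lf).
by apply: eq_bigr => i _; rewrite (scalarZ lf).
Qed.

(** The derivative of [xi] along [X]; coordinates in the frame are what gives it
    a meaning, as [g] carries no topology. *)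
Definition lie_derivative (X : G -> 'rV[R]_n) (xi : G -> g) (p : G) : g :=
  \sum_i vderiv A X (fun q => cf i (xi q)) p *: frame i.

Lemma frame_coord_derivative i X xi p :
  cf i (lie_derivative X xi p) = vderiv A X (fun q => cf i (xi q)) p.
Proof. exact: frame_coord_sum. Qed.

Lemma smooth_scalar (f : g -> R) xi : scalar f -> smooth_lie xi ->
  smooth_fun A (fun q => f (xi q)).
Proof.
move=> lf sxi; under eq_fun do rewrite (scalar_expand _ lf).
apply: (smooth_fun_sum mA) => i; apply: (smooth_funM mA) => //.
exact: smooth_fun_cst.
Qed.

Lemma vderiv_scalar (f : g -> R) X xi p : scalar f -> smooth_lie xi ->
  vderiv A X (fun q => f (xi q)) p = f (lie_derivative X xi p).
Proof.
move=> lf sxi; under eq_fun do rewrite (scalar_expand _ lf).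
rewrite (vderiv_sum mA); last first.
  by move=> i; apply: (smooth_funM mA) => //; exact: smooth_fun_cst.
rewrite (scalar_expand _ lf); apply: eq_bigr => i _.
rewrite (vderivM mA) //; last exact: smooth_fun_cst.
by rewrite vderiv_cst mulr0 add0r frame_coord_derivative.
Qed.

Section Bilinear.
Variable f : g -> g -> R.
Hypotheses (fl : forall Y, scalar (f ^~ Y)) (flr : forall X, scalar (f X)).

Lemma bilinear_expand xi eta :
  (fun q : G => f (xi q) (eta q)) =
  (fun q => \sum_i cf i (xi q) * f (frame i) (eta q)).
Proof. by apply/funext => q; rewrite (scalar_expand _ (fl _)). Qed.

Lemma smooth_bilinear xi eta : smooth_lie xi -> smooth_lie eta ->
  smooth_fun A (fun q => f (xi q) (eta q)).
Proof.
move=> sxi seta; rewrite bilinear_expand.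
apply: (smooth_fun_sum mA) => i; apply: (smooth_funM mA) => //.
exact: smooth_scalar.
Qed.

Lemma vderiv_bilinear X xi eta p : smooth_lie xi -> smooth_lie eta ->
  vderiv A X (fun q => f (xi q) (eta q)) p =
  f (lie_derivative X xi p) (eta p) + f (xi p) (lie_derivative X eta p).
Proof.
move=> sxi seta; rewrite bilinear_expand (vderiv_sum mA); last first.
  by move=> i; apply: (smooth_funM mA) => //; exact: smooth_scalar.
rewrite (scalar_expand (lie_derivative X xi p) (fl _)) (scalar_expand (xi p) (fl _)).
rewrite -big_split; apply: eq_bigr => i _ /=.
rewrite (vderivM mA) //; last exact: smooth_scalar.
by rewrite (vderiv_scalar _ _ (flr _)) // frame_coord_derivative addrC.
Qed.

End Bilinear.

Lemma frame_coord_comp i (F : g -> g) : linear F -> scalar (fun X => cf i (F X)).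
Proof. by move=> lF a X Y /=; rewrite lF (frame_coord_linear LA). Qed.

Lemma smooth_lie_linear (F : g -> g) xi : linear F -> smooth_lie xi ->
  smooth_lie (fun q => F (xi q)).
Proof. by move=> lF sxi i; apply: (smooth_scalar (frame_coord_comp i lF)). Qed.

Lemma lie_derive_linear (F : g -> g) X xi p : linear F -> smooth_lie xi ->
  lie_derivative X (fun q => F (xi q)) p = F (lie_derivative X xi p).
Proof.
move=> lF sxi; apply: frame_coord_inj => i.
by rewrite frame_coord_derivative (vderiv_scalar _ _ (frame_coord_comp i lF)).
Qed.

Lemma smooth_lie_bilinear (F : g -> g -> g) xi eta :
  (forall Y, linear (F ^~ Y)) -> (forall X, linear (F X)) ->
  smooth_lie xi -> smooth_lie eta -> smooth_lie (fun q => F (xi q) (eta q)).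
Proof.
move=> Fl Fr sxi seta i; apply: (@smooth_bilinear (fun X Y => cf i (F X Y))) => //.
  by move=> Y; exact: (frame_coord_comp i (Fl Y)).
by move=> X; exact: (frame_coord_comp i (Fr X)).
Qed.

Lemma smooth_lieD xi eta : smooth_lie xi -> smooth_lie eta ->
  smooth_lie (fun q => xi q + eta q).
Proof.
move=> sxi seta i; under eq_fun do rewrite (scalarD (frame_coord_linear LA i)).
exact: (smooth_funD mA).
Qed.

Lemma smooth_lie_derive X xi : smooth_vfield A X -> smooth_lie xi ->
  smooth_lie (lie_derivative X xi).
Proof.
move=> sX sxi i; under eq_fun do rewrite frame_coord_derivative.
exact: smooth_fun_vderiv.
Qed.

Lemma lie_derive_cst X Y p : lie_derivative X (fun=> Y) p = 0.
Proof. by rewrite /lie_derivative big1 // => i _; rewrite vderiv_cst scale0r. Qed.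

Lemma lie_derive_leibniz X f xi eta p :
  smooth_fun A f -> smooth_lie xi -> smooth_lie eta ->
  lie_derivative X (fun q => f q *: xi q + eta q) p =
  vderiv A X f p *: xi p + f p *: lie_derivative X xi p + lie_derivative X eta p.
Proof.
move=> sf sxi seta; apply: frame_coord_inj => i; have lc := frame_coord_linear LA i.
rewrite frame_coord_derivative !(scalarD lc) !(scalarZ lc) !frame_coord_derivative.
under eq_fun do rewrite lc.
rewrite (vderivD mA) //; last exact: (smooth_funM mA).
by rewrite (vderivM mA) // [f p * _ + _]addrC.
Qed.

Lemma lie_derive_pointwise X Y Z xi p a :
  Z p = a *: X p + Y p ->
  lie_derivative Z xi p = a *: lie_derivative X xi p + lie_derivative Y xi p.
Proof.
move=> e; apply: frame_coord_inj => i; have lc := frame_coord_linear LA i.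
rewrite lc !frame_coord_derivative (@vderiv_linear _ _ _ _ _ _ X Y Z a 1) ?mul1r //.
by rewrite scale1r.
Qed.

Lemma smooth_maurer_cartan_app X : smooth_vfield A X -> smooth_lie (mc X).
Proof. exact: (smooth_maurer_cartan lieG LA). Qed.

Lemma maurer_cartanE X xi : (forall q, X q = L (xi q) q) -> mc X = xi.
Proof. by move=> e; apply/funext => q; rewrite /maurer_cartan e (evK lieG LA). Qed.

Lemma maurer_cartan_ev X : mc (L X) = fun=> X.
Proof. exact: maurer_cartanE. Qed.

(** The differential of a field is the derivative of its coefficients in the
    frame plus a term that depends on the coefficients at [p] only; the latter is
    the same for the left-invariant field with the same value at [p]. *)
Lemma diff_local_rep (X Y : G -> 'rV[R]_n) p : smooth_vfield A Y ->
  'd (local_rep A Y p) (phi A p p) (X p) =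
  L (lie_derivative X (mc Y) p) p +
  \sum_j cf j (mc Y p) *: 'd (local_rep A (L (frame j)) p) (phi A p p) (X p).
Proof.
move=> sY; have cp := cod_phi (dom_self mA p).
have pp := phiK mA (dom_self mA p).
have -> : local_rep A Y p = fun x =>
    \sum_j cf j (mc Y (psi A p x)) *: local_rep A (L (frame j)) p x.
  apply/funext => x; rewrite (local_rep_frame lieG LA (xi := mc Y)) // => q.
  by rewrite (maurer_cartanK lieG LA).
have d j := is_diff_scale
  (differentiableP (smooth_fun_differentiable (smooth_maurer_cartan_app sY j) cp))
  (differentiableP (smooth_on_differentiable (smooth_ev LA (frame j) p) cp)).
have [_ E] := is_diff_sum (index_enum _) d.
rewrite [LHS](congr1 (@^~ (X p)) E) big_split /= addrC pp.
congr (_ + _); rewrite /lie_derivative (ev_sum LA); apply: eq_bigr => j _.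
by rewrite (evZ LA) (local_rep_self mA).
Qed.

(** By [diff_local_rep], the terms in which no coefficient is differentiated are
    those of the bracket of the left-invariant fields that agree with [X] and [Y]
    at [p], and these are known from the bracket of [g]. *)
Lemma vbracketE (X Y : G -> 'rV[R]_n) p : smooth_vfield A X -> smooth_vfield A Y ->
  vbracket A X Y p =
  L (lie_derivative X (mc Y) p - lie_derivative Y (mc X) p + lie (mc X p) (mc Y p)) p.
Proof.
move=> sX sY.
have [_ _ _ brL] := LA.
have sL Z := smooth_ev LA Z.
set x := mc X p; set y := mc Y p.
rewrite (evD LA p _ (lie x y)) (evB LA p (lie_derivative X (mc Y) p)).
(* E2 is E1 for the fields that are left-invariant with the same values at p *)
have E1 := f_equal2 (fun u v => u - v) (diff_local_rep X p sY) (diff_local_rep Y p sX).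
have E2 := f_equal2 (fun u v => u - v)
  (diff_local_rep (L x) p (sL y)) (diff_local_rep (L y) p (sL x)).
rewrite -[LHS]/(_ - _) [LHS]E1 brL [X in _ = _ + X]E2.
rewrite !maurer_cartan_ev !lie_derive_cst (ev0 LA p) !add0r.
rewrite (maurer_cartanK lieG LA X p) (maurer_cartanK lieG LA Y p).
by rewrite opprD addrACA.
Qed.

End Derivations.

(** * The left-invariant structure is weak HKT *)

(** The derivative terms of the Nijenhuis tensor cancel for any complex
    structure with constant coefficients in the frame; [w] and [k] are the
    brackets in [g] of an abelian structure. *)
Lemma nijenhuis_cancel (R : nzRingType) (V : lmodType R) (f : {linear V -> V})
    (x y u v w k : V) : (forall z, f (f z) = - z) ->
  f (x - y + w - (f u - f v + w)) - (u - f y - k + (f x - v + k)) = 0.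
Proof.
move=> ff.
rewrite opprD addrACA subrr addr0 !linearB /= !ff.
rewrite [u - _ - k + _]addrACA addNr addr0.
apply/eqP; rewrite subr_eq0; apply/eqP.
by rewrite !opprK addrACA [RHS]addrACA [f x + u]addrC.
Qed.

Lemma torsion_cancel (V : zmodType) (u v w k l : V) :
  u + k - (v + l) - (u - v + w) = k - l - w.
Proof.
by rewrite (opprD v) (addrACA u) (opprD (u - v)) (addrACA (u - v)) subrr add0r.
Qed.

Lemma leibniz_cancel (V : zmodType) (u v w k l : V) :
  u + v + w + (k + l) = u + (v + k) + (w + l).
Proof. by rewrite addrACA -!addrA. Qed.

Section HKT.
Context {R : realType} {n : nat} {G : topologicalGroupType}.
Variable A : charts 'rV[R]_n G.
Hypothesis lieG : is_lie_group A.
Context {g : lieAlgebraType R}.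
Variable L : g -> G -> 'rV[R]_n.
Hypothesis LA : is_lie_algebra_of A L.
Variable J : 'I_3 -> 'End(g).
Hypothesis aJ : abelian_hypercomplex_lie J.
Variable b : g -> g -> R.
Hypothesis ib : inner_product b.
Hypothesis bJ : forall i X Y, b (J i X) (J i Y) = b X Y.

Let mA : is_manifold A. Proof. by have [] := lieG. Qed.
Local Notation mc := (maurer_cartan L).
Local Notation lie_derive := (lie_derivative lieG LA).
Local Notation JG := (left_inv_endo L J).
Local Notation bG := (left_inv_metric L b).

Lemma left_translate_linear p : linear (left_translate L p).
Proof.
move=> a u v; rewrite -[RHS](evK lieG LA p) (ev_linear LA p).
by rewrite !(left_translateK lieG LA).
Qed.

Lemma maurer_cartan_linear f X Y :
  mc (fun p => f p *: X p + Y p) = fun p => f p *: mc X p + mc Y p.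
Proof. by apply/funext => p; exact: left_translate_linear. Qed.

Lemma maurer_cartan_app_endo i X : mc (app_endo (JG i) X) = fun p => J i (mc X p).
Proof. exact: (maurer_cartanE lieG LA). Qed.

Lemma J_linear i : linear (J i).
Proof. by move=> a X Y; rewrite linearP. Qed.

Lemma smooth_app_endo i X : smooth_vfield A X -> smooth_vfield A (app_endo (JG i) X).
Proof.
move=> sX; apply: (smooth_vfield_lie lieG LA (xi := fun p => J i (mc X p))).
exact: (smooth_lie_linear lieG LA (J_linear i) (smooth_maurer_cartan lieG LA sX)).
Qed.

Lemma lie_derive_app_endo i X Y p : smooth_vfield A Y ->
  lie_derive X (mc (app_endo (JG i) Y)) p = J i (lie_derive X (mc Y) p).
Proof.
move=> sY; rewrite maurer_cartan_app_endo.
exact: (lie_derive_linear _ _ _ _ (J_linear i) (smooth_maurer_cartan lieG LA sY)).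
Qed.

Lemma nijenhuis_left_inv i X Y : smooth_vfield A X -> smooth_vfield A Y ->
  nijenhuis (vbracket A) (app_endo (JG i)) X Y = 0.
Proof.
move=> sX sY; have sJX := smooth_app_endo i sX; have sJY := smooth_app_endo i sY.
have [[[JJ _] _] ab] := aJ.
have JL Z p : JG i p (L Z p) = L (J i Z) p by rewrite /left_inv_endo (evK lieG LA).
apply/funext => p.
pose JX := app_endo (JG i) X; pose JY := app_endo (JG i) Y.
suff : JG i p (vbracket A X Y p - vbracket A JX JY p) -
    (vbracket A JX Y p + vbracket A X JY p) = 0 by [].
rewrite (vbracketE lieG LA p sX sY) (vbracketE lieG LA p sJX sJY).
rewrite (vbracketE lieG LA p sJX sY) (vbracketE lieG LA p sX sJY).
rewrite !lie_derive_app_endo // maurer_cartan_app_endo maurer_cartan_app_endo.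
rewrite ab (lie_J_swap aJ).
have JJ' Z : J i (J i Z) = - Z := JJ i Z.
set x := lie_derive X _ p; set y := lie_derive Y _ p.
set u := lie_derive _ (mc Y) p; set v := lie_derive _ (mc X) p.
set w := lie _ _; set k := lie _ _.
rewrite -(evB LA) JL -(evD LA) -(evB LA).
have e := nijenhuis_cancel x y u v w k JJ'.
apply: etrans (ev0 LA p).
congr (L _ p).
exact: e.
Qed.

Lemma inner_product_left_inv p : inner_product (bG p).
Proof.
have [bl bC bp] := ib; split=> [a u v w|u v|u u0]; rewrite /left_inv_metric //.
  by rewrite left_translate_linear bl.
apply: bp; apply: contra_neq u0 => u0.
by rewrite -(left_translateK lieG LA p u) u0 (ev0 LA).
Qed.

Lemma hyperhermitian_left_inv : hyperhermitian A JG bG.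
Proof.
have [[[JJ JK] _] _] := aJ.
have lt p Z : left_translate L p (L Z p) = Z := evK lieG LA p Z.
split.
- split.
  + move=> i; split=> [p a u v|X]; last exact: smooth_app_endo.
    by rewrite /left_inv_endo left_translate_linear J_linear (ev_linear LA).
  + move=> p; split=> [i u|u]; rewrite /left_inv_endo !lt.
      have -> : J i (J i (left_translate L p u)) = - left_translate L p u := JJ i _.
      by rewrite -scaleN1r (evZ LA) (left_translateK lieG LA) scaleN1r.
    have [e1 e2] := JK (left_translate L p u); split; first by rewrite e1.
    by rewrite e2 -scaleN1r (evZ LA) scaleN1r.
  + exact: nijenhuis_left_inv.
- split=> [p|X Y sX sY]; first exact: inner_product_left_inv.
  by apply: (smooth_bilinear lieG LA (inner_product_scalarl ib)
       (inner_product_scalarr ib)); exact: smooth_maurer_cartan.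
- by move=> i p u v; rewrite /left_inv_metric /left_inv_endo !lt bJ.
Qed.

Section BismutConnection.
Variable B : g -> g -> g.
Hypotheses (Bl : forall Y, linear (B ^~ Y)) (Br : forall X, linear (B X)).
Hypothesis BE : forall X Y Z, b (B X Y) Z = - b X (lie Y Z).

(** [B] is the connection form in the left-invariant frame. *)
Definition bismut (X Y : G -> 'rV[R]_n) (p : G) : 'rV[R]_n :=
  L (lie_derive X (mc Y) p + B (mc X p) (mc Y p)) p.

Lemma maurer_cartan_bismut X Y :
  mc (bismut X Y) = fun p => lie_derive X (mc Y) p + B (mc X p) (mc Y p).
Proof. exact: (maurer_cartanE lieG LA). Qed.

Lemma connection_bismut : connection A bismut.
Proof.
split.
- move=> X Y sX sY; apply: (smooth_vfield_lie lieG LA).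
  apply: (smooth_lieD lieG LA).
    exact: (smooth_lie_derive lieG LA sX (smooth_maurer_cartan lieG LA sY)).
  by apply: (smooth_lie_bilinear lieG LA Bl Br); exact: smooth_maurer_cartan.
- move=> f X X' Y sf sX sX' sY; apply/funext => p; rewrite /bismut maurer_cartan_linear.
  rewrite (@lie_derive_pointwise _ _ _ _ lieG _ _ LA X X' _ _ p (f p)) //.
  by rewrite (Bl (mc Y p) (f p) (mc X p)) addrACA -scalerDr (ev_linear LA).
- move=> f X Y Y' sf sX sY sY'; apply/funext => p; rewrite /bismut maurer_cartan_linear.
  rewrite (lie_derive_leibniz lieG LA) //; try exact: smooth_maurer_cartan.
  rewrite (Br (mc X p) (f p) (mc Y p)) -{1}(maurer_cartanK lieG LA Y p).
  rewrite -(evZ LA) -(evZ LA) -!(evD LA) scalerDr; congr (L _ p).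
  exact: leibniz_cancel.
Qed.

(** The derivative terms of the torsion and of the bracket of vector fields
    cancel, which leaves a tensor. *)
Lemma torsion_form_bismut X Y Z p :
  smooth_vfield A Y -> smooth_vfield A Z ->
  torsion_form A bG bismut X Y Z p = torsion3 b (mc X p) (mc Y p) (mc Z p).
Proof.
move=> sY sZ; rewrite /torsion_form /app_metric /left_inv_metric -/(mc X p).
rewrite /torsion (vbracketE lieG LA) // /bismut -!(evB LA) (evK lieG LA).
set x := mc X p; set y := mc Y p; set z := mc Z p.
rewrite torsion_cancel.
have br := inner_product_scalarr ib x.
rewrite !(scalarB br) !(inner_productC ib x) !BE (inner_productC ib _ x).
by rewrite /torsion3 (lieC y x) (scalarN (inner_product_scalarr ib _)); ring.
Qed.

Lemma bismut_connection_bismut : bismut_connection A JG bG bismut.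
Proof.
split.
- exact: connection_bismut.
- move=> X Y Z sX sY sZ p.
  have sy := smooth_maurer_cartan lieG LA sY; have sz := smooth_maurer_cartan lieG LA sZ.
  have := vderiv_bilinear lieG LA (inner_product_scalarl ib)
    (inner_product_scalarr ib) X p sy sz.
  rewrite /app_metric /left_inv_metric -/(mc _ p) => ->.
  rewrite -/(mc (bismut X Y) p) -/(mc (bismut X Z) p) !maurer_cartan_bismut.
  rewrite (scalarD (inner_product_scalarl ib _)) (scalarD (inner_product_scalarr ib _)).
  rewrite (inner_productC ib (mc Y p) (B _ _)) !BE (lieC (mc Y p)).
  by rewrite (scalarN (inner_product_scalarr ib _)); ring.
- move=> i X Y sX sY; apply/funext => p.
  rewrite /app_endo /left_inv_endo -/(mc (bismut X Y) p) maurer_cartan_bismut.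
  rewrite -/(app_endo (JG i) Y) /bismut lie_derive_app_endo // maurer_cartan_app_endo.
  by rewrite (bismut_tensor_J ib aJ bJ BE) linearD.
- have bil_smooth X Y Z : smooth_vfield A X -> smooth_vfield A Y ->
      smooth_vfield A Z ->
      smooth_fun A (fun p => b (mc X p) (lie (mc Y p) (mc Z p))).
    move=> sX sY sZ.
    apply: (smooth_bilinear lieG LA (inner_product_scalarl ib)
              (inner_product_scalarr ib)).
      exact: smooth_maurer_cartan.
    apply: (smooth_lie_bilinear lieG LA (@lie_linear_l _ g) (@lie_linear_r _ g));
      exact: smooth_maurer_cartan.
  split.
  + move=> X Y Z sX sY sZ.
    have -> : torsion_form A bG bismut X Y Z = fun p =>
        (-1) * (b (mc X p) (lie (mc Y p) (mc Z p)) + b (mc Y p) (lie (mc Z p) (mc X p))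
         + b (mc Z p) (lie (mc X p) (mc Y p))).
      by apply/funext => p; rewrite torsion_form_bismut // mulN1r.
    apply: (smooth_funM mA); first exact: smooth_fun_cst.
    by do 2?apply: (smooth_funD mA); exact: bil_smooth.
  + move=> f X X' Y Z sf sX sX' sY sZ; apply/funext => p.
    by rewrite !torsion_form_bismut // maurer_cartan_linear (torsion3_linear ib).
  + move=> X Y Z sX sY sZ p; rewrite !torsion_form_bismut //.
    exact: torsion3_skew.
Qed.

End BismutConnection.

Lemma HKT_left_inv : HKT A JG bG.
Proof.
split; first exact: hyperhermitian_left_inv.
have [B [Bl Br BE]] := exists_bismut_tensor ib.
by exists (bismut B); exact: bismut_connection_bismut.
Qed.

(** Every Bismut connection has the same torsion on left-invariant fields. The
    form [a] is skew in its last two arguments because the metric is constant on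
    these fields; [d] compares it with the tensor of [exists_bismut_tensor] and
    vanishes by [skew_tensor_eq0]. *)
Lemma torsion_form_ev D X Y Z p : bismut_connection A JG bG D ->
  torsion_form A bG D (L X) (L Y) (L Z) p = torsion3 b X Y Z.
Proof.
move=> [_ Dg DJ [_ _ cskew]].
have sL W := smooth_ev LA W.
have [[[JJ _] _] ab] := aJ.
have ibp := inner_product_left_inv p.
pose a X Y Z := bG p (D (L X) (L Y) p) (L Z p).
have bL X' Y' : bG p (L X' p) (L Y' p) = b X' Y'.
  by rewrite /left_inv_metric !(evK lieG LA).
have aC X' Y' Z' : a X' Y' Z' = - a X' Z' Y'.
  have := Dg (L X') (L Y') (L Z') (sL _) (sL _) (sL _) p.
  have -> : app_metric bG (L Y') (L Z') = fun=> b Y' Z'.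
    by apply/funext => q; rewrite /app_metric /left_inv_metric !(evK lieG LA).
  rewrite vderiv_cst /app_metric [X in _ + X](inner_productC ibp).
  by rewrite -/(a X' Y' Z') -/(a X' Z' Y'); lra.
have aN X' Y' Z' : a X' (- Y') Z' = - a X' Y' Z'.
  rewrite !(aC X' _ Z') opprK /a -(scaleN1r Y') (evZ LA).
  by rewrite (scalarZ (inner_product_scalarr ibp _)) mulN1r opprK.
have aJJ X' Y' Z' : a X' (J 0 Y') (J 0 Z') = a X' Y' Z'.
  have eJ W : L (J 0 W) = app_endo (JG 0) (L W).
    by apply/funext => q; rewrite /app_endo /left_inv_endo (evK lieG LA).
  rewrite /a !eJ DJ //; have [_ _ h] := hyperhermitian_left_inv; exact: h.
have cE X' Y' Z' : torsion_form A bG D (L X') (L Y') (L Z') p =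
    a Y' Z' X' - a Z' Y' X' - b X' (lie Y' Z').
  have br := inner_product_scalarr ibp (L X' p).
  have [_ _ _ brL] := LA.
  rewrite /torsion_form /app_metric /torsion -brL !(scalarB br) bL.
  by rewrite !(inner_productC ibp (L X' p)).
pose d X' Y' Z' := a X' Y' Z' + b X' (lie Y' Z').
have bN X' Y' : b X' (- Y') = - b X' Y' := scalarN (inner_product_scalarr ib X') Y'.
have d0 X' Y' Z' : d X' Y' Z' = 0.
  apply: (skew_tensor_eq0 (J := J 0)) => [W|X1 Y1 Z1|X1 Y1 Z1|X1 Y1 Z1|X1 Y1 Z1].
  - exact: JJ.
  - by rewrite /d aN lieNl bN; ring.
  - by rewrite /d aC lieC bN; ring.
  - have [] := cskew (L X1) (L Y1) (L Z1) (sL _) (sL _) (sL _) p.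
    rewrite !cE /d (lieC Z1 Y1) (lieC X1 Z1) (lieC Y1 X1) !bN.
    by lra.
  - by rewrite /d aJJ ab.
have := d0 Y Z X; have := d0 Z Y X; rewrite cE /d /torsion3 (lieC Y X) bN.
by lra.
Qed.

(** On left-invariant fields the torsion form is a constant function, so only the
    bracket terms contribute. *)
Lemma ext_deriv3_torsion_ev D X0 X1 X2 X3 p : bismut_connection A JG bG D ->
  ext_deriv3 A (torsion_form A bG D) (L X0) (L X1) (L X2) (L X3) p =
  dtorsion3 b X0 X1 X2 X3.
Proof.
move=> BD; have [_ _ _ brL] := LA.
have v0 W X Y Z : vderiv A W (torsion_form A bG D (L X) (L Y) (L Z)) p = 0.
  have -> : torsion_form A bG D (L X) (L Y) (L Z) = fun=> torsion3 b X Y Z.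
    by apply/funext => q; exact: torsion_form_ev.
  exact: vderiv_cst.
rewrite /ext_deriv3 -!brL !v0 !torsion_form_ev // /dtorsion3.
by rewrite !subr0 !addr0 add0r.
Qed.

Lemma weak_HKT_left_inv : nonabelian_lie g -> weak_HKT A JG bG.
Proof.
move=> [X [Y XY0]]; split=> [|D BD dc0]; first exact: HKT_left_inv.
apply: XY0; apply: (closed_torsion3_lie0 ib aJ) => X0 X1 X2 X3.
rewrite -(ext_deriv3_torsion_ev X0 X1 X2 X3 1%g BD).
by apply: dc0; exact: smooth_ev.
Qed.

End HKT.

Theorem proposition2p1 (R : realType) (n : nat) (G : topologicalGroupType)
    (A : charts 'rV[R]_n G) (g : lieAlgebraType R)
    (L : g -> G -> 'rV[R]_n) (J : 'I_3 -> 'End(g)) :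
  is_lie_group A ->
  is_lie_algebra_of A L ->
  nonabelian_lie g ->
  abelian_hypercomplex_lie J ->
  forall b : g -> g -> R,
    inner_product b ->
    (forall i X Y, b (J i X) (J i Y) = b X Y) ->
    weak_HKT A (left_inv_endo L J) (left_inv_metric L b).
Proof.
move=> lieG LA nab aJ b ib bJ.
exact: (weak_HKT_left_inv lieG LA aJ ib bJ nab).
Qed.
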